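(* Consider the closed-loop system, affected by disturbances $w\in\mathcal{W}$, $$\dot x(t)=(A+L_fK_f\bar C)x(t)+(B+LE)\varphi(y_f(t))+\bar B_w w(t),\qquad y_f(t)=Cx(t),\qquad (\ast)$$ with state $x(t)\in\mathbb{R}^n$ and all data as defined in the context, where $K_f\in\mathbb{R}^{n_f\times n_f}$ and $E\in\mathbb{R}^{(n_c+n_f)\times m_a}$ are gains to be designed. Let $\bar C^{\perp}\in\mathbb{R}^{n\times(n_p+n_c)}$ be a matrix such that $\bar C\,\bar C^{\perp}=0$. Assume there exist a symmetric positive definite matrix $\bar P\in\mathbb{R}^{n\times n}$, matrices $J_o\in\mathbb{R}^{(n_p+n_c)\times(n_p+n_c)}$, $J_f\in\mathbb{R}^{n_f\times n}$, $\bar K_f\in\mathbb{R}^{n_f\times n_f}$, $K_e\in\mathbb{R}^{(n_c+n_f)\times m_a}$, $\bar G\in\mathbb{R}^{m_a\times n}$, a diagonal positive definite matrix $S\in\mathbb{R}^{m_a\times m_a}$, and positive scalars $\gamma,\mu$ such that, with $$\bar J=\begin{bmatrix}\bar C^{\perp}J_o^{\top} & J_f^{\top}\end{bmatrix}^{\top}\in\mathbb{R}^{n\times n},\qquad Z=\mathrm{diag}(0_{n_p+n_c},\bar K_f),$$ $$\Psi_{12}=\bar P+A\bar J^{\top}+Z-\bar J,\quad \Psi_{13}=BS+LK_e,\quad \Psi_{22}=\mathrm{He}\{A\bar J^{\top}+Z\},\quad \Psi_{23}=\Psi_{13}-\bar G^{\top}-\bar J C^{\top},$$ the following three conditions hold: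 $$\begin{bmatrix}-\bar J-\bar J^{\top}&\Psi_{12}&\Psi_{13}&0&\bar B_w\\ \star&\Psi_{22}&\Psi_{23}&\bar J C^{\top}W^{1/2}&\bar B_w\\ \star&\star&-2S&SW^{1/2}&0\\ \star&\star&\star&-\gamma I&0\\ \star&\star&\star&\star&-R\end{bmatrix}\prec 0,$$ $$\begin{bmatrix}\bar P&\bar G_{(i)}^{\top}\\ \star&\mu\,\bar u_{(i)}^2\end{bmatrix}\succeq 0\quad\text{for } i=1,\dots,m_a,$$ $$\sigma-\mu\ge 0.$$ Then the gains $E=\begin{bmatrix}E_c^{\top}&E_f^{\top}\end{bmatrix}^{\top}=K_eS^{-1}$ and $K_f=\bar K_f(\bar C J_f^{\top})^{-1}$ are such that, with $J=\bar J^{-1}$, $P=J\bar P J^{\top}$ and, for $c>0$, $\varepsilon(P,c)=\{x\in\mathbb{R}^n:\ x^{\top}Px\le c^{-1}\}$: 1. for $w=0$, the closed-loop system $(\ast)$ is asymptotically stable in the ellipsoid $\varepsilon(P,\mu)$; 2. the energy of the actuators usage signal is limited and given by $$\int_0^{\infty}\mathrm{sat}(y_f(\tau))^{\top}W\,\mathrm{sat}(y_f(\tau))\,d\tau\le\gamma\mu^{-1};$$ 3. for any $w\in\mathcal{W}$ and any initial condition $x(0)\in\varepsilon(P,\beta)$ with $0<\beta^{-1}\le\mu^{-1}-\sigma^{-1}$, the trajectories of $(\ast)$ do not leave the ellipsoid $\varepsilon(P,\mu)$.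
   Context: Notation. $Y_{(i)}$ is the $i$th row of a matrix $Y$ and $v_{(i)}$ the $i$th component of a vector $v$. For symmetric matrices, $\succ,\succeq,\prec$ denote the usual (semi)definite orders. $\star$ denotes blocks determined by symmetry. $\mathrm{He}\{X\}=X+X^{\top}$. $\mathrm{diag}(\cdot,\cdot)$ is block-diagonal; $0_k$ is the $k\times k$ zero matrix; $I$ is an identity matrix and $0$ a null matrix of appropriate size. Saturation and deadzone. For given bounds $\bar u_{(i)}>0$, $i=1,\dots,m_a$, and $s\in\mathbb{R}^{m_a}$, $\mathrm{sat}(s)$ is defined componentwise by $\mathrm{sat}(s_{(i)})=\mathrm{sign}(s_{(i)})\min\{|s_{(i)}|,\bar u_{(i)}\}$, and $\varphi(s)=\mathrm{sat}(s)-s$. Subsystems. Plant: $\dot x_p=A_px_p+B_pu_p+B_ww$, $y_p=C_px_p$, with $x_p\in\mathbb{R}^{n_p}$, $u_p\in\mathbb{R}^{m_c}$, $y_p\in\mathbb{R}^{q}$, $w\in\mathbb{R}^{n_w}$; $(A_p,B_p)$ is controllable and $(C_p,A_p)$ observable. Controller: $\dot x_c=A_cx_c+B_cy_p+E_c\varphi(y_f)$, $y_c=C_cx_c+D_cy_p$, with $x_c\in\mathbb{R}^{n_c}$, $y_c\in\mathbb{R}^{m_c}$, $E_c\in\mathbb{R}^{n_c\times m_a}$. Influence matrix: $M\in\mathbb{R}^{m_c\times m_a}$ known (no uncertainty), of full row rank, with $m_a>m_c$; $u_p=M\,\mathrm{sat}(y_f)$. $M^{\dagger}$ is the right pseudo-inverse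 of $M$ ($MM^{\dagger}=I$); $n_f=m_a-m_c$; the columns of $N\in\mathbb{R}^{m_a\times n_f}$ form a basis of $\ker M$. Dynamic allocator: $\dot x_f=K_fN^{\top}WNx_f+K_fN^{\top}WM^{\dagger}y_c+E_f\varphi(y_f)$, $y_f=Nx_f+M^{\dagger}y_c$, with $x_f\in\mathbb{R}^{n_f}$, $E_f\in\mathbb{R}^{n_f\times m_a}$, and $W\in\mathbb{R}^{m_a\times m_a}$ a given diagonal positive definite weighting matrix. Closed-loop data. $x=[x_p^{\top}\ x_c^{\top}\ x_f^{\top}]^{\top}\in\mathbb{R}^n$, $n=n_p+n_c+n_f$; $$A_0=\begin{bmatrix}A_p+B_pD_cC_p&B_pC_c\\ B_cC_p&A_c\end{bmatrix},\quad A=\begin{bmatrix}A_0&0\\ 0&0_{n_f}\end{bmatrix},\quad B=\begin{bmatrix}B_p\\ 0\end{bmatrix}M\in\mathbb{R}^{n\times m_a},\quad \bar B_w=\begin{bmatrix}B_w\\ 0\\ 0\end{bmatrix}\in\mathbb{R}^{n\times n_w},$$ $$C=\begin{bmatrix}M^{\dagger}D_cC_p&M^{\dagger}C_c&N\end{bmatrix},\quad \bar C=N^{\top}WC,\quad E=\begin{bmatrix}E_c\\ E_f\end{bmatrix},\quad L=\begin{bmatrix}L_c&L_f\end{bmatrix},$$ $$L_c=\begin{bmatrix}0_{n_c\times n_p}&I_{n_c}&0_{n_c\times n_f}\end{bmatrix}^{\top},\quad L_f=\begin{bmatrix}0_{n_f\times n_p}&0_{n_f\times n_c}&I_{n_f}\end{bmatrix}^{\top}.$$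 Standing assumption: $A_0$ is Hurwitz. Disturbances. For given $\sigma>0$ and symmetric positive definite $R\in\mathbb{R}^{n_w\times n_w}$, $\mathcal{W}=\{w:[0,\infty)\to\mathbb{R}^{n_w}:\ \int_0^{\infty}w(\tau)^{\top}Rw(\tau)\,d\tau<\sigma^{-1}\}$. ''Asymptotically stable in the ellipsoid $\varepsilon(P,\mu)$'' means that the origin is asymptotically stable and $\varepsilon(P,\mu)$ is contained in its basin of attraction. *)

(* Defs.v *)
From HB Require Import structures.
From mathcomp Require Import all_boot all_order all_algebra.
From mathcomp Require Import all_classical all_reals all_analysis.
From mathcomp Require Import complex.

Set Implicit Arguments.
Unset Strict Implicit.
Unset Printing Implicit Defensive.

Import Order.TTheory GRing.Theory Num.Theory.
Import numFieldNormedType.Exports.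

Local Open Scope classical_set_scope.
Local Open Scope ring_scope.

Section Matrices.
Context {R : realType}.

Definition qform {n} (X : 'M[R]_n) (v : 'cV[R]_n) : R := (v^T *m X *m v) 0 0.

Definition posdefmx {n} (X : 'M[R]_n) : Prop :=
  X^T = X /\ forall v : 'cV[R]_n, v != 0 -> 0 < qform X v.

Definition possemidefmx {n} (X : 'M[R]_n) : Prop :=
  X^T = X /\ forall v : 'cV[R]_n, 0 <= qform X v.

Definition negdefmx {n} (X : 'M[R]_n) : Prop :=
  X^T = X /\ forall v : 'cV[R]_n, v != 0 -> qform X v < 0.

Definition He {n} (X : 'M[R]_n) : 'M[R]_n := X + X^T.

(* Symmetric block matrix given by its upper blocks, [X Y; * Z]; nesting it in
   the last argument gives the matrices with more blocks. *)
Definition symblock {m n} (X : 'M[R]_m) (Y : 'M[R]_(m, n)) (Z : 'M[R]_n)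
    : 'M[R]_(m + n) :=
  block_mx X Y Y^T Z.

(* Square root of a nonnegative diagonal matrix (only used for such). *)
Definition sqrt_diagmx {n} (D : 'M[R]_n) : 'M[R]_n :=
  diag_mx (\row_i Num.sqrt (D i i)).

Definition hurwitz {n} (X : 'M[R]_n) : Prop :=
  forall z : R[i],
    eigenvalue (map_mx (fun a : R => a%:C%C) X) z ->
    complex.Re z < 0.

(* The Moore-Penrose choice M^T (M M^T)^-1 is one instance. *)
Definition right_pseudo_inverse {m n} (M : 'M[R]_(m, n)) (Md : 'M[R]_(n, m))
    : Prop :=
  M *m Md = 1%:M.

(* The columns of N form a basis of the kernel of v |-> M v; MathComp's row
   spaces and row kernels are turned into columns by transposition. *)
Definition ker_basis {m n k} (M : 'M[R]_(m, n)) (N : 'M[R]_(n, k)) : Prop :=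
  row_free N^T /\ (N^T == kermx M^T)%MS.

Definition ellipsoid {n} (P : 'M[R]_n) (c : R) : set 'cV[R]_n :=
  [set x | qform P x <= c^-1].

End Matrices.

Section Saturation.
Context {R : realType} {m : nat}.

Definition sat (ubar s : 'cV[R]_m) : 'cV[R]_m :=
  \col_i (Num.sg (s i 0) * Num.min `|s i 0| (ubar i 0)).

Definition deadzone (ubar s : 'cV[R]_m) : 'cV[R]_m := sat ubar s - s.

End Saturation.

Section Trajectories.
Context {R : realType}.

Local Notation mu := (@lebesgue_measure R).

Definition halfline : set R := `[0, +oo[.

Definition loc_integrable {n} (u : R -> 'cV[R]_n) : Prop :=
  forall i t, 0 <= t -> mu.-integrable `[0, t] (fun s => (u s i 0)%:E).

(* Caratheodory solutions on [0, +oo[ of x' = f t x: x is locally absolutely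
   continuous and solves the equation almost everywhere, expressed by the
   integral equation.  Inputs and disturbances are only measurable, so that x
   need not be differentiable everywhere. *)
Definition is_trajectory {n} (f : R -> 'cV[R]_n -> 'cV[R]_n)
    (x : R -> 'cV[R]_n) : Prop :=
  loc_integrable (fun s => f s (x s)) /\
  forall i t, 0 <= t ->
    x t i 0 = x 0 i 0 + \int[mu]_(s in `[0, t]) (f s (x s) i 0).

Definition controllable {n m} (A : 'M[R]_n) (B : 'M[R]_(n, m)) : Prop :=
  forall x0 x1 : 'cV[R]_n, exists T : R, exists u : R -> 'cV[R]_m,
    exists x : R -> 'cV[R]_n,
    [/\ 0 < T, loc_integrable u,
        is_trajectory (fun t xi => A *m xi + B *m u t) x,
        x 0 = x0 & x T = x1].

Definition observable {n q} (C : 'M[R]_(q, n)) (A : 'M[R]_n) : Prop :=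
  forall x1 x2 : R -> 'cV[R]_n,
    is_trajectory (fun _ xi => A *m xi) x1 ->
    is_trajectory (fun _ xi => A *m xi) x2 ->
    (forall t, 0 <= t -> C *m x1 t = C *m x2 t) -> x1 0 = x2 0.

Definition lyapunov_stable {n} (f : R -> 'cV[R]_n -> 'cV[R]_n) : Prop :=
  forall e : R, 0 < e -> exists2 d : R, 0 < d &
    forall x, is_trajectory f x -> `|x 0| < d ->
    forall t, 0 <= t -> `|x t| < e.

Definition basin {n} (f : R -> 'cV[R]_n -> 'cV[R]_n) : set 'cV[R]_n :=
  [set x0 | forall x, is_trajectory f x -> x 0 = x0 ->
            x t @[t --> +oo] --> (0 : 'cV[R]_n)].

Definition asymptotically_stable {n} (f : R -> 'cV[R]_n -> 'cV[R]_n) : Prop :=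
  lyapunov_stable f /\ nbhs (0 : 'cV[R]_n) (basin f).

Definition asymptotically_stable_in {n} (f : R -> 'cV[R]_n -> 'cV[R]_n)
    (D : set 'cV[R]_n) : Prop :=
  asymptotically_stable f /\ D `<=` basin f.

Definition disturbances {n} (sigma : R) (Q : 'M[R]_n) : set (R -> 'cV[R]_n) :=
  [set w : R -> 'cV[R]_n |
    (forall i, measurable_fun halfline (fun t : R => w t i 0)) /\
    (\int[mu]_(t in halfline) (qform Q (w t))%:E < (sigma^-1)%:E)%E].

(* Extended-real valued: a bound by a real number includes finiteness. *)
Definition actuator_energy {m} (W : 'M[R]_m) (ubar : 'cV[R]_m)
    (y : R -> 'cV[R]_m) : \bar R :=
  (\int[mu]_(t in halfline) (qform W (sat ubar (y t)))%:E)%E.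

End Trajectories.

(* Main.v *)
(* Idea.  With y = J^T x, r = J^T x', z = S^-1 phi and v = gamma^-1 W^(1/2) sat
   in the first matrix inequality, the multiplier J makes the terms in x' cancel
   and the form becomes, with V = x^T P x and G = bG J^T,
     V' + gamma^-1 sat^T W sat - w^T Rw w - 2 z^T (sat + G x).
   The second inequality gives |G_i x| <= ubar_i on the ellipsoid, where the
   last term is nonnegative (sector condition of the deadzone).  The first
   inequality is strict, so theta (V + 2 z^T G x) can be added to the form for
   some theta in ]0, 1[ : then
     V' + gamma^-1 sat^T W sat + theta V <= w^T Rw w
   holds already where (1 - theta) |G_i x| <= ubar_i, i.e. on an ellipsoid
   strictly larger than epsilon(P, mu).  Trajectories starting on the boundary
   of epsilon(P, mu) are thus covered by a real induction on time, and all the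
   claims follow by integrating this inequality.  As w is only measurable,
   V(x(t)) is only absolutely continuous; the product rule needed to integrate
   V' is obtained from Fubini's theorem on a triangle. *)
Require Import Defs.
From HB Require Import structures.
From mathcomp Require Import all_boot all_order all_algebra.
From mathcomp Require Import all_classical all_reals all_analysis.
From mathcomp Require Import measurable_realfun ring lra.

Set Implicit Arguments.
Unset Strict Implicit.
Unset Printing Implicit Defensive.

Import Order.TTheory GRing.Theory Num.Theory.
Import numFieldNormedType.Exports.

Local Open Scope classical_set_scope.
Local Open Scope ring_scope.

(** * Positive definite matrices *)

Section DotProduct.
Context {R : realType}.

Definition dotv {n} (a b : 'cV[R]_n) : R := (a^T *m b) 0 0.

Lemma dotvE n (a b : 'cV[R]_n) : dotv a b = \sum_i a i 0 * b i 0.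
Proof. by rewrite /dotv mxE; apply: eq_bigr => i _; rewrite mxE. Qed.

Lemma dotvC n (a b : 'cV[R]_n) : dotv a b = dotv b a.
Proof. by rewrite !dotvE; apply: eq_bigr => i _; rewrite mulrC. Qed.

Lemma dotvDr n (a b c : 'cV[R]_n) : dotv a (b + c) = dotv a b + dotv a c.
Proof. by rewrite /dotv mulmxDr mxE. Qed.

Lemma dotvDl n (a b c : 'cV[R]_n) : dotv (a + b) c = dotv a c + dotv b c.
Proof. by rewrite !(dotvC _ c) dotvDr. Qed.

Lemma dotvNr n (a b : 'cV[R]_n) : dotv a (- b) = - dotv a b.
Proof. by rewrite /dotv mulmxN mxE. Qed.

Lemma dotvNl n (a b : 'cV[R]_n) : dotv (- a) b = - dotv a b.
Proof. by rewrite dotvC dotvNr dotvC. Qed.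

Lemma dotvZr n k (a b : 'cV[R]_n) : dotv a (k *: b) = k * dotv a b.
Proof. by rewrite /dotv -scalemxAr mxE. Qed.

Lemma dotvZl n k (a b : 'cV[R]_n) : dotv (k *: a) b = k * dotv a b.
Proof. by rewrite dotvC dotvZr dotvC. Qed.

Lemma dotv0 n (a : 'cV[R]_n) : dotv a 0 = 0.
Proof. by rewrite /dotv mulmx0 mxE. Qed.

Lemma dotv_mulmxr m n (X : 'M[R]_(m, n)) a b :
  dotv a (X *m b) = dotv (X^T *m a) b.
Proof. by rewrite /dotv trmx_mul trmxK mulmxA. Qed.

Lemma dotv_mulmxl m n (X : 'M[R]_(m, n)) a b :
  dotv (X *m a) b = dotv a (X^T *m b).
Proof. by rewrite dotv_mulmxr trmxK. Qed.

Lemma dotv_col m n (a c : 'cV[R]_m) (b d : 'cV[R]_n) :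
  dotv (col_mx a b) (col_mx c d) = dotv a c + dotv b d.
Proof. by rewrite /dotv tr_col_mx mul_row_col mxE. Qed.

Lemma dotv_delta n (v : 'cV[R]_n) i : dotv (delta_mx i 0) v = v i 0.
Proof.
rewrite dotvE (bigD1 i) //= mxE !eqxx mul1r big1 ?addr0 // => j ji.
by rewrite mxE (negPf ji) mul0r.
Qed.

Lemma qformE n (X : 'M[R]_n) v : qform X v = dotv v (X *m v).
Proof. by rewrite /qform /dotv mulmxA. Qed.

Lemma qform_delta n (X : 'M[R]_n) i : qform X (delta_mx i 0) = X i i.
Proof.
rewrite qformE dotv_delta mxE (bigD1 i)//= mxE !eqxx mulr1.
by rewrite big1 ?addr0// => j ji; rewrite mxE (negPf ji) mulr0.
Qed.

Lemma qformN n (X : 'M[R]_n) v : qform (- X) v = - qform X v.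
Proof. by rewrite !qformE mulNmx dotvNr. Qed.

Lemma qform_He n (X : 'M[R]_n) v : qform (He X) v = 2 * qform X v.
Proof.
rewrite /He !qformE mulmxDl dotvDr (dotv_mulmxr X^T) trmxK (dotvC (X *m v)).
by rewrite mulr_natl.
Qed.

Lemma qform_symblock m n (X : 'M[R]_m) (Y : 'M[R]_(m, n)) (Z : 'M[R]_n) a b :
  qform (symblock X Y Z) (col_mx a b) =
    qform X a + 2 * dotv a (Y *m b) + qform Z b.
Proof.
rewrite !qformE /symblock mul_block_col dotv_col !dotvDr.
by rewrite (dotv_mulmxr Y^T) trmxK (dotvC (Y *m b)); ring.
Qed.

Lemma posdef_ge0 n (X : 'M[R]_n) v : posdefmx X -> 0 <= qform X v.
Proof.
case=> _ X0; have [->|/X0/ltW//] := eqVneq v 0.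
by rewrite qformE mulmx0 dotv0.
Qed.

(** A nonzero [u] with [u *m X = 0] would be a zero of the form. Only positivity of the form is
    assumed, so that the nonsymmetric multiplier [bJ] is covered. *)
Lemma posdef_unit n (X : 'M[R]_n) :
  (forall v, v != 0 -> 0 < qform X v) -> X \in unitmx.
Proof.
move=> X0; rewrite -row_free_unit; apply/negPn/negP.
rewrite -kermx_eq0 => /rowV0Pn[u /sub_kermxP uX0 u0].
have := X0 u^T; rewrite /qform trmxK uX0 mul0mx mxE ltxx => /(_ _)/negP; apply => //.
by apply: contra_neq u0 => /(congr1 trmx); rewrite trmxK trmx0.
Qed.

Lemma posdef_diag_gt0 n (X : 'M[R]_n) i : posdefmx X -> 0 < X i i.
Proof.
move=> [_ X0]; rewrite -qform_delta; apply: X0.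
apply/eqP => /matrixP/(_ i 0); rewrite !mxE !eqxx => /eqP.
by rewrite oner_eq0.
Qed.

Lemma posdef_invmx_diag n (X : 'M[R]_n) i : posdefmx X -> 0 < (invmx X) i i.
Proof.
move=> [XT X0]; have Xu := posdef_unit X0.
have -> : invmx X i i = qform X (invmx X *m delta_mx i 0).
  rewrite qformE mulKVmx// dotvC dotv_delta mxE (bigD1 i)//= mxE !eqxx mulr1.
  by rewrite big1 ?addr0// => j ji; rewrite mxE (negPf ji) mulr0.
apply: X0; apply/eqP => /(congr1 (mulmx X)).
rewrite mulKVmx// mulmx0 => /matrixP/(_ i 0); rewrite !mxE !eqxx => /eqP.
by rewrite oner_eq0.
Qed.

(* Cauchy-Schwarz for the inner product X, applied to v and X^-1 e_i. *)
Lemma posdef_coord n (X : 'M[R]_n) (v : 'cV[R]_n) i : posdefmx X ->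
  v i 0 ^+ 2 <= (invmx X) i i * qform X v.
Proof.
move=> Xp; have [XT X0] := Xp; have Xu := posdef_unit X0.
pose u : 'cV[R]_n := invmx X *m delta_mx i 0.
have Xuv : X *m u = delta_mx i 0 by rewrite mulKVmx.
have uE : qform X u = invmx X i i.
  rewrite qformE Xuv dotvC dotv_delta mxE (bigD1 i)//= mxE !eqxx mulr1.
  by rewrite big1 ?addr0// => j ji; rewrite mxE (negPf ji) mulr0.
have key t : 0 <= qform X v - 2 * t * v i 0 + t ^+ 2 * invmx X i i.
  apply: le_trans (posdef_ge0 (v - t *: u) Xp) _.
  have Xvu : dotv v (X *m u) = v i 0 by rewrite Xuv dotvC dotv_delta.
  have Xuv' : dotv u (X *m v) = v i 0 by rewrite dotv_mulmxr XT Xuv dotv_delta.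
  rewrite -uE !qformE mulmxBr -scalemxAr !dotvDr !dotvNr !dotvDl !dotvZr.
  by rewrite !dotvNl !dotvZl Xvu Xuv'; lra.
(* This value of [t] minimises the quadratic polynomial in [key]. *)
have d0 := posdef_invmx_diag i Xp; have := key (v i 0 / invmx X i i).
rewrite -(ler_pM2l d0) mulr0.
have -> : invmx X i i * (qform X v - 2 * (v i 0 / invmx X i i) * v i 0 +
   (v i 0 / invmx X i i) ^+ 2 * invmx X i i) =
   invmx X i i * qform X v - v i 0 ^+ 2.
  by field; rewrite gt_eqF.
by rewrite subr_ge0.
Qed.

(** Each product [v_i v_j] is at most [v_i^2 + v_j^2], and [posdef_coord] bounds both squares by the
    form of [X]. The constant is explicit, so no compactness of the sphere is invoked. *)
Lemma qform_bound n (X Y : 'M[R]_n) : posdefmx X ->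
  exists2 K, 0 < K & forall v, qform Y v <= K * qform X v.
Proof.
move=> Xp; pose D i := invmx X i i.
have D0 i : 0 <= D i by exact/ltW/posdef_invmx_diag.
exists (1 + \sum_i \sum_j `|Y i j| * (D i + D j)).
  apply: ltr_pwDl => //; apply: sumr_ge0 => i _; apply: sumr_ge0 => j _.
  by rewrite mulr_ge0// addr_ge0.
move=> v; have q0 := posdef_ge0 v Xp.
rewrite qformE dotvE mulrDl mul1r; apply: ler_wpDl => //.
rewrite mulr_suml; apply: ler_sum => i _.
rewrite mxE mulr_sumr mulr_suml; apply: ler_sum => j _.
have := posdef_coord v i Xp; have := posdef_coord v j Xp.
rewrite -/(D i) -/(D j) => vj vi.
rewrite mulrCA -mulrA; apply: le_trans (ler_norm _) _.
rewrite normrM; apply: ler_wpM2l => //.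
apply: (@le_trans _ _ (v i 0 ^+ 2 + v j 0 ^+ 2)).
  rewrite normrM -(real_normK (num_real (v i 0))).
  rewrite -(real_normK (num_real (v j 0))).
  nra.
by rewrite mulrDl lerD.
Qed.

End DotProduct.

(** * The dissipation inequality *)

(** Without saturation the first factor vanishes. With saturation it has the sign opposite to [s],
    while the second is [u + g] or [- u + g], which is zero or has the sign of [s]. *)
Lemma sector_bound (R : realType) (s u g : R) : 0 < u -> `|g| <= u ->
  (Num.sg s * Num.min `|s| u - s) * (Num.sg s * Num.min `|s| u + g) <= 0.
Proof.
move=> u0; rewrite ler_norml => /andP[gl gu]; rewrite minEle.
case: ifPn => [su|]; first by rewrite -[_ * `|s|]numEsg subrr mul0r.
rewrite -ltNge; have [s0|s0|->] := ltrgt0P s.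
- by rewrite gtr0_sg// mul1r => us; nra.
- by rewrite ltr0_sg// => us; nra.
- by lra.
Qed.

Section Dissipation.
Context {R : realType} {n m k : nat}.
Implicit Types (bJ bP Acl : 'M[R]_n) (S : 'M[R]_m).

Lemma sqrt_diagmx_sq (W : 'M[R]_m) : is_diag_mx W -> posdefmx W ->
  (sqrt_diagmx W)^T *m sqrt_diagmx W = W.
Proof.
move=> Wd Wp; rewrite /sqrt_diagmx tr_diag_mx mulmx_diag.
apply/matrixP => i j; rewrite !mxE.
have [->|ij] := eqVneq i j; last by rewrite mulr0n (is_diag_mxP Wd _ _ ij).
rewrite mulr1n -expr2 sqr_sqrtr//.
by rewrite -qform_delta posdef_ge0.
Qed.

(** Collecting the terms with factor [r] or [y] leaves [2 (r + y)^T (Acl x + Bcl phi + Bw w - p)],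
    which vanishes along the dynamics [p]; what remains no longer contains [Acl], [Bcl] or [Bw]. *)
Lemma lmi_form bJ bP Acl (Bcl : 'M[R]_(n, m)) (Bw : 'M[R]_(n, k))
    (C bG : 'M[R]_(m, n)) S (Wh : 'M[R]_m) (Rw : 'M[R]_k) gamma
    (p x r y : 'cV[R]_n) (phi z v : 'cV[R]_m) (w : 'cV[R]_k) :
  S^T = S -> bJ^T *m y = x -> bJ^T *m r = p -> S *m z = phi ->
  p = Acl *m x + Bcl *m phi + Bw *m w ->
  qform (symblock (- bJ - bJ^T)
       (row_mx (bP + Acl *m bJ^T - bJ)
         (row_mx (Bcl *m S) (row_mx (0 : 'M[R]_(n, m)) Bw)))
    (symblock (He (Acl *m bJ^T))
       (row_mx (Bcl *m S - bG^T - bJ *m C^T)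
         (row_mx (bJ *m C^T *m Wh) Bw))
    (symblock (- (2 *: S)) (row_mx (S *m Wh) (0 : 'M[R]_(m, k)))
    (symblock (- gamma%:M : 'M[R]_m) (0 : 'M[R]_(m, k)) (- Rw)))))
    (col_mx r (col_mx y (col_mx z (col_mx v w)))) =
  2 * dotv r (bP *m y) - 2 * dotv z (bG *m y)
    - 2 * dotv z (C *m x + phi) + 2 * dotv (C *m x + phi) (Wh *m v)
    - gamma * dotv v v - qform Rw w.
Proof.
move=> ST yx rp Sz pE.
have bJr a : dotv r (bJ *m a) = dotv p a by rewrite dotv_mulmxr rp.
have bJy a : dotv y (bJ *m a) = dotv x a by rewrite dotv_mulmxr yx.
have rpE : dotv r p =
    dotv r (Acl *m x) + dotv r (Bcl *m phi) + dotv r (Bw *m w).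
  by rewrite [in LHS]pE !dotvDr.
have xpE : dotv y p =
    dotv y (Acl *m x) + dotv y (Bcl *m phi) + dotv y (Bw *m w).
  by rewrite [in LHS]pE !dotvDr.
have -> : dotv (C *m x + phi) (Wh *m v) =
    dotv y (bJ *m C^T *m Wh *m v) + dotv z (S *m Wh *m v).
  by rewrite -!mulmxA bJy (dotv_mulmxr S) ST Sz (dotv_mulmxr C^T) trmxK -dotvDl.
have e11 : qform (- bJ - bJ^T) r = - 2 * dotv r p.
  by rewrite qformE mulmxBl mulNmx dotvDr !dotvNr rp bJr dotvC; ring.
have e12 : dotv r ((bP + Acl *m bJ^T - bJ) *m y) =
    dotv r (bP *m y) + dotv r (Acl *m x) - dotv p y.
  by rewrite mulmxBl mulmxDl !dotvDr dotvNr bJr -mulmxA yx.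
have e13 : dotv r (Bcl *m S *m z) = dotv r (Bcl *m phi).
  by rewrite -mulmxA Sz.
have e22 : qform (He (Acl *m bJ^T)) y = 2 * dotv y (Acl *m x).
  by rewrite qform_He qformE -mulmxA yx.
have e23 : dotv y ((Bcl *m S - bG^T - bJ *m C^T) *m z) =
    dotv y (Bcl *m phi) - dotv z (bG *m y) - dotv z (C *m x).
  rewrite !mulmxBl !dotvDr !dotvNr -mulmxA Sz -mulmxA bJy.
  by rewrite !(dotv_mulmxr _^T) !trmxK !(dotvC z).
have e33 : qform (- (2 *: S)) z = - 2 * dotv z phi.
  by rewrite qformN qformE -scalemxAl Sz dotvZr mulNr.
have e44 : qform (- gamma%:M) v = - gamma * dotv v v.
  by rewrite qformN qformE mul_scalar_mx dotvZr mulNr.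
rewrite !qform_symblock !mul_row_col !dotvDr !mul0mx !dotv0.
rewrite e11 e12 e13 e22 e23 e33 e44 qformN.
by rewrite (dotvC p y); lra.
Qed.

(** A Schur complement: for fixed [y], the form is smallest when the last coordinate is
    [- (g y) / c], and its value there is [qform bP y - (g y)^2 / c]. *)
Lemma schur_bound (bP : 'M[R]_n) (g : 'rV[R]_n) c y : 0 < c ->
  possemidefmx (symblock bP g^T c%:M) -> (g *m y) 0 0 ^+ 2 <= c * qform bP y.
Proof.
move=> c0 [_ /(_ (col_mx y (- ((g *m y) 0 0 / c))%:M))].
have q1 t : qform c%:M (t%:M : 'cV[R]_1) = c * t ^+ 2.
  by rewrite qformE mul_scalar_mx dotvZr dotvE big_ord1 !mxE mulr1n.
have d1 t : dotv y (g^T *m t%:M) = t * (g *m y) 0 0.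
  by rewrite dotv_mulmxr trmxK dotvE big_ord1 !mxE mulr1n mulrC.
rewrite qform_symblock q1 d1 => h; rewrite -subr_ge0.
suff -> : c * qform bP y - (g *m y) 0 0 ^+ 2 = c * (qform bP y +
  2 * (- ((g *m y) 0 0 / c) * (g *m y) 0 0) + c * (- ((g *m y) 0 0 / c)) ^+ 2).
  by rewrite mulr_ge0// ltW.
by field; rewrite gt_eqF.
Qed.

Lemma diag_mulmx_col (S : 'M[R]_m) (z : 'cV[R]_m) i : is_diag_mx S ->
  (S *m z) i 0 = S i i * z i 0.
Proof.
move=> Sd; rewrite mxE (bigD1 i)//= big1 ?addr0// => j ji.
by rewrite (is_diag_mxP Sd) ?mul0r// eq_sym.
Qed.

(** Strict negativity leaves room for a small multiple of any quadratic form. Spending it on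
    [V + 2 z^T G x] yields the decay term [th V] and shrinks [G] to [(1 - th) G] in the sector
    condition, which therefore holds on a larger ellipsoid. *)
Lemma dissipation bJ bP Acl (Bcl : 'M[R]_(n, m)) (Bw : 'M[R]_(n, k))
    (C bG : 'M[R]_(m, n)) S (W : 'M[R]_m) (Rw : 'M[R]_k) gamma mu
    (ubar : 'cV[R]_m) :
  bJ \in unitmx -> is_diag_mx S -> posdefmx S -> is_diag_mx W -> posdefmx W ->
  0 < gamma -> 0 < mu -> (forall i, 0 < ubar i 0) ->
  negdefmx (symblock (- bJ - bJ^T)
       (row_mx (bP + Acl *m bJ^T - bJ)
         (row_mx (Bcl *m S) (row_mx (0 : 'M[R]_(n, m)) Bw)))
    (symblock (He (Acl *m bJ^T))
       (row_mx (Bcl *m S - bG^T - bJ *m C^T)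
         (row_mx (bJ *m C^T *m sqrt_diagmx W) Bw))
    (symblock (- (2 *: S)) (row_mx (S *m sqrt_diagmx W) (0 : 'M[R]_(m, k)))
    (symblock (- gamma%:M : 'M[R]_m) (0 : 'M[R]_(m, k)) (- Rw))))) ->
  (forall i, possemidefmx
    (symblock bP (row i bG)^T (mu * ubar i 0 ^+ 2)%:M)) ->
  let P := invmx bJ *m bP *m (invmx bJ)^T in
  exists2 th, 0 < th < 1 & forall x w,
    let p := Acl *m x + Bcl *m deadzone ubar (C *m x) + Bw *m w in
    mu * (1 - th) ^+ 2 * qform P x <= 1 ->
    2 * dotv p (P *m x) + gamma^-1 * qform W (sat ubar (C *m x))
      + th * qform P x <= qform Rw w.
Proof.
move=> bJu Sd Sp Wd Wp g0 mu0 u0; set X := symblock _ _ _ => Xn L2 P.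
have Xp : posdefmx (- X).
  case: Xn => XT X0; split; first by rewrite raddfN /= XT.
  by move=> v v0; rewrite qformN oppr_gt0 X0.
(* Only the blocks in [y] and [z] are nonzero: the form of [Y] is [V + 2 z^T bG y]. *)
pose Y : 'M[R]_(n + (n + (m + (m + k)))) :=
  symblock 0 0 (symblock bP (row_mx bG^T 0) 0).
have [K K0 KX] := qform_bound Y Xp.
(* Gives both [th < 1] and [th * K <= 1], so [th] times the form of [Y] is absorbed. *)
pose th := (K + 1)^-1.
have th0 : 0 < th by rewrite invr_gt0; lra.
have thK : th * (K + 1) = 1 by rewrite mulVf// gt_eqF//; lra.
have th1 : th < 1 by nra.
exists th; first by rewrite th0.
move=> x w p Vx.
pose y := (invmx bJ)^T *m x; pose r := (invmx bJ)^T *m p.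
pose phi := deadzone ubar (C *m x); pose z := invmx S *m phi.
pose s := sat ubar (C *m x).
(* This [v] maximises [2 s^T Wh v - gamma v^T v], with maximum [gamma^-1 s^T W s]. *)
pose Wh := sqrt_diagmx W; pose v := gamma^-1 *: (Wh *m s).
have VE : qform P x = qform bP y.
  by rewrite !qformE /P /y -!mulmxA dotv_mulmxr.
have yx : bJ^T *m y = x by rewrite mulmxA -trmx_mul mulVmx// trmx1 mul1mx.
have rp : bJ^T *m r = p by rewrite mulmxA -trmx_mul mulVmx// trmx1 mul1mx.
have Sz : S *m z = phi by rewrite mulKVmx// posdef_unit//; case: Sp.
pose q := col_mx r (col_mx y (col_mx z (col_mx v w))).
have := posdef_ge0 q Xp; have := KX q.
rewrite qformN (lmi_form bP C bG Wh Rw gamma v (proj1 Sp) yx rp Sz (erefl p)).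
have -> : C *m x + phi = s by rewrite /phi /deadzone addrC subrK.
rewrite /Y !qform_symblock !mul_row_col !mul0mx !dotv0 !addr0.
rewrite ![qform 0 _]qformE !mul0mx !dotv0 add0r mulr0 !addr0 add0r.
have -> : dotv r (bP *m y) = dotv p (P *m x).
  by rewrite /P /r /y -!mulmxA dotv_mulmxl trmxK.
have -> : dotv y (bG^T *m z) = dotv z (bG *m y).
  by rewrite dotv_mulmxr trmxK dotvC.
have Whv : dotv s (Wh *m v) = gamma^-1 * qform W s.
  rewrite /v -scalemxAr dotvZr qformE -{1}(sqrt_diagmx_sq Wd Wp).
  by rewrite mulmxA /Wh {1}/sqrt_diagmx -tr_diag_mx.
have vv : gamma * dotv v v = gamma^-1 * qform W s.
  rewrite /v dotvZr dotvZl dotv_mulmxl mulmxA sqrt_diagmx_sq// -qformE.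
  by field; rewrite gt_eqF.
have gi i : (bG *m y) i 0 ^+ 2 <= mu * ubar i 0 ^+ 2 * qform P x.
  have c0 : 0 < mu * ubar i 0 ^+ 2 by rewrite mulr_gt0// exprn_gt0.
  by have := schur_bound y c0 (L2 i); rewrite -row_mul mxE -VE.
(* Coordinatewise: [S i i > 0] turns [z_i] into the deadzone [phi_i], and [gi] with [Vx] bounds
   [(1 - th) (bG y)_i] by [ubar_i]. *)
have sect : dotv z (s + (1 - th) *: (bG *m y)) <= 0.
  move: (bG *m y) gi => gy gi.
  rewrite dotvE; apply: sumr_le0 => i _.
  have Si := posdef_diag_gt0 i Sp.
  rewrite -(pmulr_rle0 _ Si) mulrA -diag_mulmx_col// Sz !mxE.
  apply: sector_bound => //.
  rewrite -ler_sqr ?nnegrE ?normr_ge0 ?(ltW (u0 i))//.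
  rewrite real_normK ?num_real// exprMn.
  apply: le_trans (ler_wpM2l (sqr_ge0 (1 - th)) (gi i)) _.
  have := ler_wpM2l (sqr_ge0 (ubar i 0)) Vx; rewrite mulr1.
  by apply: le_trans; rewrite le_eqVlt; apply/orP; left; apply/eqP; ring.
rewrite Whv vv VE; move: sect; rewrite dotvDr dotvZr -/s.
set a := dotv p (P *m x); set g := dotv z (bG *m y); set b := dotv z s.
set e := gamma^-1 * _; set o := qform Rw w; set V := qform bP y.
set Q := - (_ - o) => sect Kle Q0.
have : th * (V + 2 * g) <= Q.
  apply: le_trans (ler_wpM2l (ltW th0) Kle) _.
  by rewrite mulrA ler_piMl//; lra.
by rewrite /Q; lra.
Qed.

End Dissipation.

(** * Absolutely continuous functions *)

Section IntegralCalculus.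
Context {R : realType}.
Local Notation mu := (@lebesgue_measure R).

Lemma integral_cstM (c : R) (A : set R) (g : R -> R) : measurable A ->
  mu.-integrable A (EFin \o g) ->
  (\int[mu]_(r in A) (c * g r)%:E = (c * \int[mu]_(r in A) g r)%:E)%E.
Proof.
move=> mA ig; under eq_integral do rewrite EFinM.
rewrite integralZl// EFinM /Rintegral fineK//.
exact: integrable_fin_num.
Qed.

(** Both sides integrate [f(s) g(r)] over the half-plane [r <= s], in the two orders. *)
Lemma Rintegral_triangle (f g : R -> R) :
  mu.-integrable setT (EFin \o f) -> mu.-integrable setT (EFin \o g) ->
  \int[mu]_s (f s * \int[mu]_(r in `]-oo, s]) g r) =
  \int[mu]_r (g r * \int[mu]_(s in `[r, +oo[) f s).
Proof.
move=> intf intg; congr fine.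
pose T := measurableTypeR R.
pose h (z : T * T) : \bar R := (if z.2 <= z.1 then f z.1 * g z.2 else 0)%:E.
have /measurable_EFinP mf := measurable_int mu intf.
have /measurable_EFinP mg := measurable_int mu intg.
have mh : measurable_fun setT h.
  apply/measurable_EFinP; apply: measurable_fun_ifT => //.
    by apply: measurable_fun_ler.
  by apply: measurable_funM; apply: measurableT_comp.
have ih : ((mu \x mu)%E).-integrable setT h.
  apply/(integrable12ltyP mu mu mh).
  have [/integrableP[mf' f8] /integrableP[mg' g8]] := (intf, intg).
  (* Forgetting the constraint [r <= s] bounds the double integral by the product of the two L1
     norms. *)
  apply: (@le_lt_trans _ _
    (\int[mu]_x ((\int[mu]_y `|(g y)%:E|) * `|(f x)%:E|))%E).
    apply: ge0_le_integral => //.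
    - by move=> x _; apply: integral_ge0.
    - apply: (measurable_fun_fubini_tonelli_F (abse \o h)) => //=.
      exact: measurableT_comp.
    - by apply: measurable_funeM; apply: measurableT_comp.
    - move=> x _; rewrite muleC -ge0_integralZl//; last exact: measurableT_comp.
      apply: ge0_le_integral => //.
      + by apply: measurableT_comp => //; apply: measurableT_comp.
      + by apply: measurable_funeM; apply: measurableT_comp.
      + move=> y _; rewrite /h /=; case: ifP => _; first by rewrite normrM.
        by rewrite normr0 mule_ge0.
  rewrite ge0_integralZl//.
  - by rewrite lte_mul_pinfty// ?integral_ge0// ge0_fin_numE// integral_ge0.
  - exact: measurableT_comp.
  - exact: integral_ge0.
transitivity (\int[mu]_s \int[mu]_r h (s, r))%E.
  apply: eq_integral => s _.
  rewrite -integral_cstM//; last exact: integrableS intg.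
  rewrite integral_mkcond; apply: eq_integral => r _.
  by rewrite /h /patch/= mem_setE in_itv /=; case: ifP.
rewrite Fubini//; apply: eq_integral => r _.
rewrite -integral_cstM//; last exact: integrableS intf.
rewrite [RHS]integral_mkcond; apply: eq_integral => s _.
by rewrite /h /patch/= mem_setE in_itv /= andbT; case: ifP => //; rewrite mulrC.
Qed.

Lemma primitive_continuous (f F : R -> R) T : 0 <= T ->
  mu.-integrable `[0, T] (EFin \o f) ->
  (forall t, t \in `[0, T] -> F t = F 0 + \int[mu]_(s in `[0, t]) f s) ->
  {within `[0, T], continuous F}.
Proof.
move=> T0 intf FE.
have : {within `[0, T], continuous
    (cst (F 0) + fun t => \int[mu]_(s in `[0, t]) f s)}.
  apply: within_continuousD; first by move=> x; exact: cvg_cst.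
  exact: parameterized_integral_continuous.
apply: subspace_eq_continuous => t /set_mem tT.
exact: (esym (FE t tT)).
Qed.

Lemma within_continuous_integrable (f : R -> R) T :
  {within `[0, T], continuous f} -> mu.-integrable `[0, T] (EFin \o f).
Proof. by apply: continuous_compact_integrable; exact: segment_compact. Qed.

Lemma integrable_contM (f F : R -> R) T :
  mu.-integrable `[0, T] (EFin \o f) -> {within `[0, T], continuous F} ->
  mu.-integrable `[0, T] (EFin \o (fun s => F s * f s)).
Proof.
move=> intf cF.
have -> : EFin \o (fun s => F s * f s) = ((EFin \o F) \* (EFin \o f))%E.
  by apply/funext => s /=; rewrite EFinM.
apply: integrableMr => //.
  by apply: subspace_continuous_measurable_fun.
have /compact_bounded[M [Mr bM]] :=
  continuous_compact cF (@segment_compact _ 0 T).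
by exists M; split=> // x Mx s sT; apply: (bM x Mx); exists s.
Qed.

(** Integration by parts without pointwise derivatives. For [f] and [g] cut off outside [[0, T]],
    the inner integrals of [Rintegral_triangle] are [G s - G 0] and [F T - F r]. *)
Lemma integral_product_rule (f g F G : R -> R) T : 0 <= T ->
  mu.-integrable `[0, T] (EFin \o f) -> mu.-integrable `[0, T] (EFin \o g) ->
  (forall t, t \in `[0, T] -> F t = F 0 + \int[mu]_(s in `[0, t]) f s) ->
  (forall t, t \in `[0, T] -> G t = G 0 + \int[mu]_(s in `[0, t]) g s) ->
  F T * G T = F 0 * G 0 + \int[mu]_(s in `[0, T]) (F s * g s + G s * f s).
Proof.
move=> T0 intf intg FE GE.
have cF := primitive_continuous T0 intf FE.
have cG := primitive_continuous T0 intg GE.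
have intT (h : R -> R) : mu.-integrable `[0, T] (EFin \o h) ->
    mu.-integrable setT (EFin \o (h \_ `[0, T])).
  move=> ih; rewrite -restrict_EFin.
  by apply/integrable_restrict => //=; rewrite setTI.
have TT : T \in `[0, T] by rewrite in_itv /= T0 lexx.
have := Rintegral_triangle (intT _ intf) (intT _ intg).
have -> : \int[mu]_s ((f \_ `[0, T]) s *
      \int[mu]_(r in `]-oo, s]) (g \_ `[0, T]) r) =
    \int[mu]_(s in `[0, T]) (G s * f s - G 0 * f s).
  rewrite [RHS]Rintegral_mkcond; apply: eq_Rintegral => s _.
  rewrite /= !patchE; case: ifPn => [|_]; last by rewrite mul0r.
  rewrite inE /= => sT; rewrite GE// -Rintegral_mkcondr.
  have -> : [set` `]-oo, s]] `&` [set` `[0, T]] = [set` `[0, s]].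
    move: sT; rewrite in_itv/= => /andP[s0 sT].
    apply/seteqP; split=> r /=; rewrite !in_itv /=.
      by case=> -> /andP[->].
    by move=> /andP[-> rs]; rewrite rs (le_trans rs sT).
  by ring.
have -> : \int[mu]_r ((g \_ `[0, T]) r *
      \int[mu]_(s in `[r, +oo[) (f \_ `[0, T]) s) =
    \int[mu]_(r in `[0, T]) (F T * g r - F r * g r).
  rewrite [RHS]Rintegral_mkcond; apply: eq_Rintegral => s _.
  rewrite /= !patchE; case: ifPn => [|_]; last by rewrite mul0r.
  rewrite inE /= => sT; rewrite (FE s)// (FE T)// -Rintegral_mkcondr.
  move: sT; rewrite in_itv/= => /andP[s0 sT].
  have -> : [set` `[s, +oo[] `&` [set` `[0, T]] = [set` `[s, T]].
    apply/seteqP; split=> r /=; rewrite !in_itv /= ?andbT.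
      by case=> -> /andP[_ ->].
    by move=> /andP[sr ->]; rewrite sr (le_trans s0 sr).
  (* Dropping the endpoint [s] changes nothing and makes the integral a difference of two integrals
     from 0. *)
  rewrite -Rintegral_itv_obnd_cbnd; last first.
    by apply: integrableS intf => //; apply: subset_itvr; rewrite bnd_simp.
  rewrite -(@Rintegral_itvB _ f (BLeft 0) (BRight T))//; first by ring.
have iFg := integrable_contM intg cF; have iGf := integrable_contM intf cG.
(* The identity now reads [int (G f) - G 0 int f = F T int g - int (F g)]; the rest is linearity and
   algebra. *)
have icst (c : R) (h : R -> R) : mu.-integrable `[0, T] (EFin \o h) ->
    mu.-integrable `[0, T] (EFin \o (fun s => c * h s)).
  by move=> ih; have := integrableZl _ c ih; apply.
rewrite !RintegralB// ?RintegralD//; try exact: icst.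
rewrite !RintegralZl// => eq1.
have := FE T TT; have := GE T TT.
set a := \int[mu]_(s in _) f s; set b := \int[mu]_(s in _) g s.
move=> GT FT; have -> : \int[mu]_(x in `[0, T]) (F x * g x) +
    \int[mu]_(x in `[0, T]) (G x * f x) = F T * b + G 0 * a.
  by rewrite /a /b; lra.
by rewrite GT FT; ring.
Qed.

End IntegralCalculus.

(** * Trajectories *)

Section Barrier.
Context {R : realType}.

Lemma within_continuous_dist (V : R -> R) (D : set R) t e :
  {within D, continuous V} -> D t -> 0 < e ->
  exists2 d, 0 < d & forall r, D r -> `|t - r| < d -> `|V t - V r| < e.
Proof.
move=> /subspace_continuousP cV Dt e0.
have /cvgrPdist_lt/(_ e e0) := cV t Dt.
rewrite near_withinE => /nbhs_ballP[d /= d0 H]; exists d => // r Dr tr.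
exact: H.
Qed.

(* Real induction: on the maximal initial interval where V <= b one even has
   V <= a, so that V stays below b a little longer. *)
Lemma continuous_barrier (V : R -> R) a b T : 0 <= T ->
  {within `[0, T], continuous V} -> V 0 <= a -> a < b ->
  (forall t, 0 <= t <= T -> (forall s, 0 <= s <= t -> V s <= b) -> V t <= a) ->
  V T <= a.
Proof.
move=> T0 cV V0 ab H.
pose A := [set t | 0 <= t <= T /\ forall s, 0 <= s <= t -> V s <= b].
have A0 : A 0.
  split; first by rewrite lexx T0.
  move=> s /andP[s0 s0']; have -> : s = 0 by apply/eqP; rewrite eq_le s0 s0'.
  exact/ltW/(le_lt_trans V0).
have Aub : ubound A T by move=> t [/andP[]].
have sA : has_sup A by split; [exists 0|exists T].
pose tau := sup A.
have tauT : tau <= T by apply: ge_sup => //; exists 0.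
have tau0 : 0 <= tau by apply: ub_le_sup => //; exists T.
have tauin : `[0, T]%classic tau by rewrite /= in_itv /= tau0 tauT.
have Ve x : A x -> V x <= a by case=> xT /(H _ xT).
have below r : 0 <= r -> r < tau -> A r.
  move=> r0 rtau.
  have [t [/andP[t0 tT] At] rt] : exists2 t, A t & r < t.
    by apply: sup_gt => //; exists 0.
  split; first by rewrite r0 (le_trans (ltW rt) tT).
  by move=> s /andP[s0 sr]; apply: At; rewrite s0 (le_trans sr (ltW rt)).
(* Otherwise [V] would exceed [a] at some [r] just before [tau], against [Ve]; [tau = 0] is excluded
   by the bound on [V 0]. *)
have Vtau : V tau <= a.
  rewrite leNgt; apply/negP => aV.
  have e0 : 0 < V tau - a by rewrite subr_gt0.
  have [d d0 Hd] := within_continuous_dist cV tauin e0.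
  have tau_gt0 : 0 < tau.
    rewrite lt_neqAle tau0 andbT; apply/eqP => tE.
    by move: aV V0; rewrite -tE; lra.
  pose r := Num.max 0 (tau - d / 2).
  have r0 : 0 <= r by rewrite le_max lexx.
  have rtau : r < tau by rewrite gt_max tau_gt0; lra.
  have rT : `[0, T]%classic r by rewrite /= in_itv /= r0 (le_trans (ltW rtau)).
  have rd : tau - d / 2 <= r by rewrite le_max lexx orbT.
  have /Hd : `|tau - r| < d by rewrite gtr0_norm ?subr_gt0//; lra.
  move=> /(_ rT); have := Ve _ (below _ r0 rtau).
  by rewrite ltr_norml => ? /andP[_ ?]; lra.
have Atau : A tau.
  split; first by rewrite tau0 tauT.
  move=> s /andP[s0]; rewrite le_eqVlt => /predU1P[->|st].
    by rewrite (le_trans Vtau)// ltW.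
  by rewrite (le_trans (Ve _ (below _ s0 st)))// ltW.
(* If [tau < T], continuity keeps [V] below [b] up to some [r > tau], so [r] lies in [A], against
   the supremum. *)
have [<-//|tauT'] := eqVneq tau T.
have {}tauT' : tau < T by rewrite lt_neqAle tauT' tauT.
have e0 : 0 < b - V tau by rewrite subr_gt0 (le_lt_trans Vtau).
have [d d0 Hd] := within_continuous_dist cV tauin e0.
pose r := Num.min T (tau + d / 2).
have rtau : tau < r by rewrite lt_min tauT'; lra.
have rd : r <= tau + d / 2 by rewrite ge_min lexx orbT.
have rT : r <= T by rewrite ge_min lexx.
suff Ar : A r by have := ub_le_sup (proj2 sA) Ar; rewrite -/tau leNgt rtau.
split; first by rewrite (le_trans tau0 (ltW rtau)) rT.
move=> s /andP[s0 sr]; have [st|ts] := leP s tau.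
  by case: Atau => _; apply; rewrite s0.
have sT : `[0, T]%classic s by rewrite /= in_itv /= s0 (le_trans sr).
have /(Hd _ sT) : `|tau - s| < d by rewrite ltr0_norm ?subr_lt0//; lra.
by rewrite ltr_norml => /andP[? _]; lra.
Qed.

End Barrier.

(** * Integral calculus along trajectories *)

Section Trajectory.
Context {R : realType}.
Local Notation mu := (@lebesgue_measure R).

Lemma integrable_rsum (I : finType) T (h : I -> R -> R) :
  (forall i, mu.-integrable `[0, T] (EFin \o h i)) ->
  mu.-integrable `[0, T] (EFin \o (fun s => \sum_i h i s)).
Proof.
move=> ih.
have -> : EFin \o (fun s => \sum_i h i s) =
    (fun s => \sum_i (EFin \o h i) s)%E.
  by apply/funext => s /=; rewrite sumEFin.
exact: integrable_sum.
Qed.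

Lemma Rintegral_rsum (I : finType) T (h : I -> R -> R) :
  (forall i, mu.-integrable `[0, T] (EFin \o h i)) ->
  \int[mu]_(s in `[0, T]) (\sum_i h i s) =
  \sum_i \int[mu]_(s in `[0, T]) h i s.
Proof.
move=> ih; rewrite /Rintegral.
under eq_integral do rewrite -sumEFin.
rewrite (@integral_sum _ _ _ mu `[0, T]%classic _ I (fun i => EFin \o h i))//.
by rewrite -EFin_sum_fine// => i _; exact: integrable_fin_num.
Qed.

Lemma integrable_mulmx m n (X : 'M[R]_(m, n)) (u : R -> 'cV[R]_n) T i :
  (forall j, mu.-integrable `[0, T] (fun s => (u s j 0)%:E)) ->
  mu.-integrable `[0, T] (fun s => ((X *m u s) i 0)%:E).
Proof.
move=> iu; have -> : (fun s => ((X *m u s) i 0)%:E) =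
    EFin \o (fun s => \sum_j X i j * u s j 0).
  by apply/funext => s; rewrite mxE.
apply: integrable_rsum => j.
by have := integrableZl _ (X i j) (iu j); apply.
Qed.

Lemma Rintegral_mulmx m n (X : 'M[R]_(m, n)) (u : R -> 'cV[R]_n) T i :
  (forall j, mu.-integrable `[0, T] (fun s => (u s j 0)%:E)) ->
  \int[mu]_(s in `[0, T]) ((X *m u s) i 0) =
  \sum_j X i j * \int[mu]_(s in `[0, T]) (u s j 0).
Proof.
move=> iu; under eq_Rintegral do rewrite mxE.
rewrite Rintegral_rsum; last first.
  by move=> j; have := integrableZl _ (X i j) (iu j); apply.
by apply: eq_bigr => j _; rewrite RintegralZl//; exact: iu.
Qed.

Section Solution.
Context {n : nat} (f : R -> 'cV[R]_n -> 'cV[R]_n) (x : R -> 'cV[R]_n).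
Hypothesis fx : is_trajectory f x.
Context (T : R) (T0 : 0 <= T).

Let intf i : mu.-integrable `[0, T] (EFin \o (fun s => f s (x s) i 0)).
Proof. exact: (proj1 fx i T T0). Qed.

Let xE i t : t \in `[0, T] ->
  x t i 0 = x 0 i 0 + \int[mu]_(s in `[0, t]) (f s (x s) i 0).
Proof. by rewrite in_itv /= => /andP[t0 _]; exact: (proj2 fx). Qed.

Lemma trajectory_continuous i : {within `[0, T], continuous (fun s => x s i 0)}.
Proof. exact: primitive_continuous T0 (intf i) (xE i). Qed.

Lemma trajectory_mulmx m (X : 'M[R]_(m, n)) i t : t \in `[0, T] ->
  (X *m x t) i 0 = (X *m x 0) i 0 +
    \int[mu]_(s in `[0, t]) ((X *m f s (x s)) i 0).
Proof.
move=> tT; rewrite Rintegral_mulmx; last first.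
  move=> j; apply: integrableS (intf j) => //; apply: subset_itvl.
  by move: tT; rewrite in_itv /= bnd_simp => /andP[].
rewrite !mxE -big_split; apply: eq_bigr => j _ /=.
by rewrite xE// mulrDr.
Qed.

(** The product rule is applied to each pair [x_i], [(P x)_i], both primitives of integrable
    functions; symmetry of [P] merges the two resulting sums into [g]. *)
Lemma trajectory_qform (P : 'M[R]_n) : P^T = P ->
  let g s := 2 * dotv (f s (x s)) (P *m x s) in
  mu.-integrable `[0, T] (EFin \o g) /\
  qform P (x T) = qform P (x 0) + \int[mu]_(s in `[0, T]) g s.
Proof.
move=> PT g.
pose h i s := x s i 0 * (P *m f s (x s)) i 0 + (P *m x s) i 0 * f s (x s) i 0.
have gE : g = fun s => \sum_i h i s.
  apply/funext => s; rewrite /h big_split /= -!dotvE /g.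
  have -> : dotv (x s) (P *m f s (x s)) = dotv (f s (x s)) (P *m x s).
    by rewrite dotv_mulmxr PT dotvC.
  by rewrite (dotvC (P *m x s)); ring.
have ig i : mu.-integrable `[0, T] (EFin \o (fun s => (P *m f s (x s)) i 0)).
  exact: integrable_mulmx.
have xPE i t : t \in `[0, T] -> (P *m x t) i 0 = (P *m x 0) i 0 +
    \int[mu]_(s in `[0, t]) ((P *m f s (x s)) i 0) by exact: trajectory_mulmx.
have ih i : mu.-integrable `[0, T] (EFin \o h i).
  have i1 := integrable_contM (ig i) (@trajectory_continuous i).
  have i2 := integrable_contM (intf i) (primitive_continuous T0 (ig i) (xPE i)).
  by have := integrableD _ i1 i2; apply.
rewrite gE; split; first exact: integrable_rsum.
rewrite Rintegral_rsum// !qformE !dotvE -big_split; apply: eq_bigr => i _ /=.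
exact: integral_product_rule T0 (intf i) (ig i) (xE i) (xPE i).
Qed.

End Solution.

End Trajectory.

(** * Comparison of quadratic forms with the sup norm *)

Section NormBounds.
Context {R : realType} {n : nat}.

Lemma coord_le_norm (v : 'cV[R]_n) i : `|v i 0| <= `|v|.
Proof.
by rewrite [leRHS]/Num.norm /= mx_normrE; apply: (le_bigmax _ _ (i, 0)).
Qed.

Lemma norm_sq_le (v : 'cV[R]_n) K : 0 <= K ->
  (forall i, v i 0 ^+ 2 <= K) -> `|v| ^+ 2 <= K.
Proof.
move=> K0 vK; have [->|] := eqVneq `|v| 0; first by rewrite expr0n.
move=> /mx_norm_neq0[[i j] /= vE].
have -> : `|v| = `|v i 0| by rewrite -(ord1 j).
by rewrite real_normK// num_real.
Qed.

(** The norm is the largest absolute value of a coordinate, and [posdef_coord] bounds each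
    coordinate. The added 1 keeps the constant positive in dimension 0. *)
Lemma posdef_norm_le (P : 'M[R]_n) : posdefmx P ->
  exists2 K, 0 < K & forall v, `|v| ^+ 2 <= K * qform P v.
Proof.
move=> Pp; exists (1 + \sum_i invmx P i i).
  apply: ltr_pwDl => //; apply: sumr_ge0 => i _.
  exact/ltW/posdef_invmx_diag.
move=> v; have q0 := posdef_ge0 v Pp.
have D0 i : 0 <= invmx P i i by exact/ltW/posdef_invmx_diag.
apply: norm_sq_le => [|i].
  by rewrite mulr_ge0// addr_ge0// sumr_ge0.
apply: le_trans (posdef_coord v i Pp) _; apply: ler_wpM2r => //.
by rewrite (bigD1 i)//= addrCA lerDl addr_ge0// sumr_ge0.
Qed.

Lemma qform_le_norm (P : 'M[R]_n) :
  exists2 K, 0 < K & forall v, qform P v <= K * `|v| ^+ 2.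
Proof.
exists (1 + \sum_i \sum_j `|P i j|).
  by apply: ltr_pwDl => //; apply: sumr_ge0 => i _; apply: sumr_ge0.
move=> v; rewrite mulrDl mul1r; apply: ler_wpDl; first exact: sqr_ge0.
rewrite qformE dotvE mulr_suml; apply: ler_sum => i _.
rewrite mxE mulr_sumr mulr_suml; apply: ler_sum => j _.
apply: le_trans (ler_norm _) _; rewrite mulrCA normrM; apply: ler_wpM2l => //.
by rewrite normrM expr2 ler_pM// coord_le_norm.
Qed.

Lemma ellipsoid_nbhs (P : 'M[R]_n) c : 0 < c ->
  nbhs (0 : 'cV[R]_n) (ellipsoid P c).
Proof.
move=> c0; have [K K0 PK] := qform_le_norm P.
have cK : 0 < (c * K)^-1 by rewrite invr_gt0 mulr_gt0.
apply/nbhs_ballP; exists (Num.sqrt (c * K)^-1); first by rewrite /= sqrtr_gt0.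
move=> v; rewrite -ball_normE /= sub0r normrN => vd.
rewrite /ellipsoid /=; apply: le_trans (PK v) _.
have : `|v| ^+ 2 <= (c * K)^-1.
  by rewrite -(sqr_sqrtr (ltW cK)) ler_sqr ?nnegrE ?normr_ge0 ?sqrtr_ge0// ltW.
move=> /(ler_wpM2l (ltW K0))/le_trans; apply.
by rewrite invfM mulrCA divff ?mulr1// gt_eqF.
Qed.

End NormBounds.

(** * Continuity of the saturated output *)

Section SatContinuity.
Context {R : realType}.
Implicit Types T : R.

Lemma within_continuous_sum (I : finType) T (h : I -> R -> R) :
  (forall i, {within `[0, T], continuous (h i)}) ->
  {within `[0, T], continuous (fun s => \sum_i h i s)}.
Proof.
move=> ch; elim: (index_enum I) => [|i r IH].
  have -> : (fun s => \sum_(i <- [::]) h i s) = cst 0.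
    by apply/funext => s; rewrite big_nil.
  by move=> s; exact: cvg_cst.
have -> : (fun s => \sum_(j <- i :: r) h j s) =
    (h i + fun s => \sum_(j <- r) h j s).
  by apply/funext => s; rewrite big_cons.
exact: (within_continuousD (ch i) IH).
Qed.

Lemma within_continuousM T (f g : R -> R) :
  {within `[0, T], continuous f} -> {within `[0, T], continuous g} ->
  {within `[0, T], continuous (fun s => f s * g s)}.
Proof. by move=> cf cg s; apply: cvgM; [exact: cf|exact: cg]. Qed.

Lemma within_continuous_mulmx m n (X : 'M[R]_(m, n)) (u : R -> 'cV[R]_n) T i :
  (forall j, {within `[0, T], continuous (fun s => u s j 0)}) ->
  {within `[0, T], continuous (fun s => (X *m u s) i 0)}.
Proof.
move=> cu; have -> : (fun s => (X *m u s) i 0) =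
    fun s => \sum_j X i j * u s j 0 by apply/funext => s; rewrite mxE.
apply: within_continuous_sum => j.
by apply: within_continuousM => // s; exact: cvg_cst.
Qed.

Lemma within_continuous_qform n (P : 'M[R]_n) (u : R -> 'cV[R]_n) T :
  (forall j, {within `[0, T], continuous (fun s => u s j 0)}) ->
  {within `[0, T], continuous (fun s => qform P (u s))}.
Proof.
move=> cu; have -> : (fun s => qform P (u s)) =
    fun s => \sum_j u s j 0 * (P *m u s) j 0.
  by apply/funext => s; rewrite qformE dotvE.
apply: within_continuous_sum => j.
by apply: within_continuousM => //; exact: within_continuous_mulmx.
Qed.

(** The sign function jumps at 0; this expression in absolute values makes continuity of the
    saturation immediate. *)
Lemma satE m (ubar s : 'cV[R]_m) i : 0 < ubar i 0 ->
  sat ubar s i 0 = (`|s i 0 + ubar i 0| - `|s i 0 - ubar i 0|) / 2.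
Proof.
rewrite mxE; move: (s i 0) (ubar i 0) => a u u0.
case: (ltrgt0P a) => [a0|a0|->].
- rewrite gtr0_sg// mul1r [`|a + u|]gtr0_norm; last lra.
  by case: leP => ?; [rewrite ler0_norm|rewrite gtr0_norm]; lra.
- rewrite ltr0_sg// mulN1r [`|a - u|]ltr0_norm; last lra.
  by case: leP => ?; [rewrite ger0_norm|rewrite ltr0_norm]; lra.
- by rewrite sgr0 mul0r add0r sub0r normrN subrr mul0r.
Qed.

Lemma within_continuous_sat m (ubar : 'cV[R]_m) (y : R -> 'cV[R]_m) T i :
  0 < ubar i 0 ->
  {within `[0, T], continuous (fun s => y s i 0)} ->
  {within `[0, T], continuous (fun s => sat ubar (y s) i 0)}.
Proof.
move=> u0 cy; have -> : (fun s => sat ubar (y s) i 0) =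
    fun s => (`|y s i 0 + ubar i 0| - `|y s i 0 - ubar i 0|) / 2.
  by apply/funext => s; rewrite satE.
move=> s; apply: cvgM; last exact: cvg_cst.
apply: cvgB; apply: cvg_norm; [apply: cvgD|apply: cvgB];
  by [exact: cy|exact: cvg_cst].
Qed.

End SatContinuity.

(** * Integrating a dissipation inequality valid on a sublevel set *)

Section DissipationInequality.
Context {R : realType} {n : nat}.
Local Notation mu := (@lebesgue_measure R).
Variables (P : 'M[R]_n) (f : R -> 'cV[R]_n -> 'cV[R]_n) (x : R -> 'cV[R]_n).
Variables (psi : 'cV[R]_n -> R) (r : R -> R) (b : R).
Hypothesis PT : P^T = P.
Hypothesis fx : is_trajectory f x.
Hypothesis psi_ge0 : forall xi, 0 <= psi xi.
Hypothesis psi_cont : forall T, 0 <= T ->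
  {within `[0, T], continuous (fun s => psi (x s))}.
Hypothesis ir : forall T, 0 <= T -> mu.-integrable `[0, T] (EFin \o r).
Hypothesis dissip : forall t xi, 0 <= t -> qform P xi <= b ->
  2 * dotv (f t xi) (P *m xi) + psi xi <= r t.

Lemma qform_trajectory_continuous T : 0 <= T ->
  {within `[0, T], continuous (fun s => qform P (x s))}.
Proof.
move=> T0; apply: within_continuous_qform => j.
exact: (@trajectory_continuous _ _ _ _ fx T T0 j).
Qed.

Lemma storage_le_below T : 0 <= T ->
  (forall s, 0 <= s <= T -> qform P (x s) <= b) ->
  qform P (x T) + \int[mu]_(s in `[0, T]) psi (x s) <=
  qform P (x 0) + \int[mu]_(s in `[0, T]) r s.
Proof.
move=> T0 Vb; have [ig ->] := trajectory_qform fx T0 PT.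
have ip := within_continuous_integrable (psi_cont T0).
rewrite -addrA lerD2l -RintegralD//; apply: le_Rintegral => //.
- by have := integrableD _ ig ip; apply.
- exact: ir.
- move=> s /=; rewrite in_itv /= => /andP[s0 sT].
  by apply: dissip => //; apply: Vb; rewrite s0.
Qed.

(** As long as [V <= b], [storage_le_below] and [psi >= 0] bound [V] by initial storage plus supply,
    hence by [a]. This is the improvement from [b] to [a] that [continuous_barrier] asks for. *)
Lemma storage_le a T : a < b -> 0 <= T ->
  (forall t, 0 <= t ->
    qform P (x 0) + \int[mu]_(s in `[0, t]) r s <= a) ->
  qform P (x T) <= a /\
  qform P (x T) + \int[mu]_(s in `[0, T]) psi (x s) <=
  qform P (x 0) + \int[mu]_(s in `[0, T]) r s.
Proof.
move=> ab T0 Va.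
have Vt t : 0 <= t -> qform P (x t) <= a.
  move=> t0.
  apply: (continuous_barrier t0 (qform_trajectory_continuous t0) _ ab).
    by have := Va 0 (lexx _); rewrite set_itv1 Rintegral_set1 addr0.
  move=> s /andP[s0 _] Vb; apply: le_trans (Va s s0).
  apply: le_trans (storage_le_below s0 Vb).
  by rewrite lerDl Rintegral_ge0.
split; first exact: Vt.
apply: storage_le_below => // s /andP[s0 _].
by rewrite (le_trans (Vt s s0))// ltW.
Qed.

End DissipationInequality.

(** * Asymptotic stability from a decay term *)

Section Decay.
Context {R : realType} {n : nat}.
Local Notation mu := (@lebesgue_measure R).
Variables (P : 'M[R]_n) (f : R -> 'cV[R]_n -> 'cV[R]_n) (th a b : R).
Hypothesis Pp : posdefmx P.
Hypothesis th0 : 0 < th.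
Hypothesis a0 : 0 < a.
Hypothesis ab : a < b.
Hypothesis dissip : forall t xi, 0 <= t -> qform P xi <= b ->
  2 * dotv (f t xi) (P *m xi) + th * qform P xi <= 0.

Lemma Rintegral0 T : \int[mu]_(s in `[0, T]) (0 : R) = 0.
Proof. by rewrite Rintegral_cst// mul0r. Qed.

Lemma integrable_cst0 T : mu.-integrable `[0, T] (EFin \o (fun=> 0 : R)).
Proof. exact: integrable0. Qed.

(** Zero supply gives [V(T) + int (th V) <= V(0)]. As [V] is nonincreasing, the integral is at least
    [th T V(T)]. This decay of order [1/T] suffices for convergence to 0. *)
Lemma decay x T : is_trajectory f x -> qform P (x 0) <= a -> 0 <= T ->
  qform P (x T) <= qform P (x 0) /\ th * T * qform P (x T) <= qform P (x 0).
Proof.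
move=> fx xa T0; have [PT _] := Pp.
have V0 xi : 0 <= qform P xi by exact: posdef_ge0.
have cV t : 0 <= t -> {within `[0, t], continuous (fun s => qform P (x s))}.
  exact: (@qform_trajectory_continuous _ _ P f x fx t).
have psi0 xi : 0 <= th * qform P xi by rewrite mulr_ge0// ltW.
have psic t : 0 <= t ->
    {within `[0, t], continuous (fun s => th * qform P (x s))}.
  move=> t0; apply: within_continuousM; last exact: cV.
  by move=> s; exact: cvg_cst.
have Va t : 0 <= t ->
    qform P (x 0) + \int[mu]_(s in `[0, t]) (0 : R) <= qform P (x 0).
  by rewrite Rintegral0 addr0.
have xb : qform P (x 0) < b by exact: le_lt_trans ab.
have ir t : 0 <= t -> mu.-integrable `[0, t] (EFin \o (fun=> 0 : R)).
  by move=> _; exact: integrable_cst0.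
have H t (t0 : 0 <= t) := storage_le PT fx psi0 psic ir dissip xb t0 Va.
have [VT ET] := H T T0; split=> //.
have mono s : 0 <= s <= T -> qform P (x T) <= qform P (x s).
  move=> /andP[s0 sT].
  have [ig ->] := trajectory_qform fx T0 PT.
  have [_ ->] := trajectory_qform fx s0 PT.
  rewrite lerD2l -subr_le0 (Rintegral_itvB ig)//.
  have -> : (0 : R) = \int[mu]_(x in `]s, T]) (0 : R).
    by rewrite Rintegral_cst// mul0r.
  apply: le_Rintegral => //.
  - by apply: integrableS ig => //; apply: subset_itvr; rewrite bnd_simp.
  - exact: integrable0.
  move=> t /=; rewrite in_itv /= => /andP[st _].
  have t0 : 0 <= t by rewrite (le_trans s0)// ltW.
  have Vt : qform P (x t) <= b by rewrite (le_trans (proj1 (H t t0)))// ltW.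
  have := dissip t0 Vt; have := V0 (x t); have := psi0 (x t); lra.
have : th * T * qform P (x T) <= \int[mu]_(s in `[0, T]) (th * qform P (x s)).
  have -> : th * T * qform P (x T) =
      \int[mu]_(s in `[0, T]) (th * qform P (x T)).
    rewrite Rintegral_cst//= lebesgue_measure_itv/= lte_fin.
    (* The length of the interval is given by a test [0 < T], so [T = 0] is treated apart. *)
    case: ltP T0 => //= [T0 _|T0' T0].
      by rewrite subr0; ring.
    by rewrite (_ : T = 0) ?mulr0 ?mul0r//; apply/eqP; rewrite eq_le T0 T0'.
  apply: le_Rintegral => //.
  - apply: within_continuous_integrable => s; exact: cvg_cst.
  - exact: within_continuous_integrable (psic T T0).
  - move=> s; rewrite /= in_itv /= => sT.
    by apply: ler_wpM2l; [exact: ltW|exact: mono].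
by move: ET; rewrite Rintegral0 addr0; have := V0 (x T); lra.
Qed.

(** Attraction comes from the [1/T] bound, stability from the monotonicity of [V], both transferred
    to the norm by comparison with [P]. *)
Lemma decay_asymptotically_stable :
  asymptotically_stable_in f (ellipsoid P a^-1).
Proof.
have [K1 K10 NK] := posdef_norm_le Pp.
have [K2 K20 KN] := qform_le_norm P.
have sub : ellipsoid P a^-1 `<=` basin f.
  move=> x0; rewrite /ellipsoid /= invrK => x0a x fx xE.
  have xa : qform P (x 0) <= a by rewrite xE.
  have H t (t0 : 0 <= t) := decay fx xa t0.
  apply/cvgrPdist_lt => e e0.
  near=> t.
  have t0 : 0 < t by near: t; exact: nbhs_pinfty_gt.
  rewrite sub0r normrN -ltr_sqr ?nnegrE ?normr_ge0 ?(ltW e0)//.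
  apply: le_lt_trans (NK _) _; have [_] := H t (ltW t0); rewrite xE => Ht.
  (* After this time [K1 V(x t) <= K1 a / (th t) < e^2]. *)
  have : K1 * a / (th * e ^+ 2) < t.
    by near: t; apply: nbhs_pinfty_gt; exact: num_real.
  rewrite ltr_pdivrMr; last by rewrite mulr_gt0// exprn_gt0.
  have tt : 0 < th * t by rewrite mulr_gt0.
  move=> Kt; rewrite -(ltr_pM2l tt).
  apply: le_lt_trans (_ : K1 * a < _); last by move: Kt; lra.
  by rewrite mulrCA ler_pM2l// (le_trans Ht).
split=> //; split; last first.
  by apply: filterS sub _; apply: ellipsoid_nbhs; rewrite invr_gt0.
move=> e e0.
(* The bound [a] lets [decay] apply; the factor 2 makes the final inequality strict. *)
pose c := Num.min a (e ^+ 2 / (2 * K1)).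
have c0 : 0 < c by rewrite lt_min a0 divr_gt0// ?exprn_gt0// mulr_gt0.
have cK : 0 < c / K2 by rewrite divr_gt0.
exists (Num.sqrt (c / K2)); first by rewrite sqrtr_gt0.
move=> x fx x0d t t0.
have x0c : qform P (x 0) <= c.
  apply: le_trans (KN _) _; rewrite -ler_pdivlMl// mulrC.
  by rewrite -(sqr_sqrtr (ltW cK)) ler_sqr ?nnegrE ?normr_ge0 ?sqrtr_ge0// ltW.
have [|Vt _] := decay fx _ t0; first by rewrite (le_trans x0c)// ge_min lexx.
rewrite -ltr_sqr ?nnegrE ?normr_ge0 ?(ltW e0)//.
apply: le_lt_trans (NK _) _.
have : qform P (x t) <= e ^+ 2 / (2 * K1).
  by rewrite (le_trans Vt)// (le_trans x0c)// ge_min lexx orbT.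
move=> /(ler_wpM2l (ltW K10))/le_lt_trans; apply.
have -> : K1 * (e ^+ 2 / (2 * K1)) = e ^+ 2 / 2 by field; rewrite gt_eqF.
by have := exprn_gt0 2 e0; lra.
Unshelve. all: by end_near. Qed.

End Decay.

(** * The closed loop *)

Section HalflineIntegrals.
Context {R : realType}.
Local Notation mu := (@lebesgue_measure R).

(** Monotone convergence along the exhausting intervals [[0, i]]. *)
Lemma integral_halfline_le (g : R -> R) c : (forall t, 0 <= g t) ->
  (forall T, 0 <= T -> {within `[0, T], continuous g}) ->
  (forall T, 0 <= T -> \int[mu]_(s in `[0, T]) g s <= c) ->
  (\int[mu]_(t in halfline) (g t)%:E <= c%:E)%E.
Proof.
move=> g0 cg gc.
rewrite /halfline itv_bndy_bigcup_BRight.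
pose F (i : nat) : set (measurableTypeR R) := `[0, 0 + i%:R]%classic.
have mF i : measurable (F i) by exact: measurable_itv.
have Fi (i : nat) : mu.-integrable (F i) (EFin \o g).
  by apply: within_continuous_integrable; apply: cg; rewrite add0r.
have limF : (\int[mu]_(x in F i) (g x)%:E)%E @[i --> \oo] -->
    (\int[mu]_(x in \bigcup_i F i) (g x)%:E)%E.
  apply: (@ge0_nondecreasing_set_cvg_integral _ _ R F (EFin \o g)) => //=.
  - move=> i j ij; rewrite subsetEset; apply: subset_itvl.
    by rewrite bnd_simp lerD2l ler_nat.
  - by move=> i; exact: (measurable_int mu (Fi i)).
  - by move=> i t _; rewrite lee_fin.
rewrite -(cvg_lim _ limF)//; apply: lime_le.
  by apply/cvg_ex; eexists; exact: limF.
apply: nearW => i.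
rewrite -[leLHS]fineK; last exact: (integrable_fin_num (mF i) (Fi i)).
by rewrite lee_fin; apply: gc; rewrite add0r.
Qed.

(** The form of [w] is measurable and nonnegative, so finite energy makes it integrable on the
    half-line, and restriction to [[0, T]] only lowers the integral. *)
Lemma disturbance_integral n (Q : 'M[R]_n) sigma (w : R -> 'cV[R]_n) T :
  posdefmx Q -> disturbances sigma Q w -> 0 <= T ->
  mu.-integrable `[0, T] (EFin \o (fun t => qform Q (w t))) /\
  \int[mu]_(t in `[0, T]) qform Q (w t) <= sigma^-1.
Proof.
move=> Qp [mw iw] T0.
have sub : `[0, T]%classic `<=` halfline by exact: subset_itvl.
have mq : measurable_fun halfline (fun t => qform Q (w t)).
  have -> : (fun t => qform Q (w t)) =
      fun t => \sum_i w t i 0 * (\sum_j Q i j * w t j 0).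
    apply/funext => t; rewrite qformE dotvE; apply: eq_bigr => i _.
    by rewrite mxE.
  apply: measurable_sum => i; apply: measurable_funM; first exact: mw.
  by apply: measurable_sum => j; apply: measurable_funM => //; exact: mw.
have ih : mu.-integrable halfline (EFin \o (fun t => qform Q (w t))).
  apply/integrableP; split; first exact/measurable_EFinP.
  under eq_integral do rewrite gee0_abs ?lee_fin ?posdef_ge0//.
  exact: lt_trans iw (ltry _).
have iT : mu.-integrable `[0, T] (EFin \o (fun t => qform Q (w t))).
  by apply: integrableS ih => //; exact: measurable_itv.
split=> //; rewrite -lee_fin fineK; last exact: integrable_fin_num.
apply: le_trans (ltW iw); apply: ge0_subset_integral => //.
- exact: measurable_itv.
- exact/measurable_EFinP.
- by move=> t _; rewrite lee_fin posdef_ge0.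
Qed.

End HalflineIntegrals.

(** * Stability, actuator energy and invariance from the dissipation inequality *)

Section ClosedLoop.
Context {R : realType} {n m k : nat}.
Local Notation mu := (@lebesgue_measure R).
Variables (Acl : 'M[R]_n) (Bcl : 'M[R]_(n, m)) (Bw : 'M[R]_(n, k)).
Variables (C : 'M[R]_(m, n)) (W : 'M[R]_m) (Rw : 'M[R]_k) (P : 'M[R]_n).
Variables (ubar : 'cV[R]_m) (gamma nu sigma th : R).
Hypothesis Pp : posdefmx P.
Hypothesis Wp : posdefmx W.
Hypothesis Rwp : posdefmx Rw.
Hypothesis ubar_gt0 : forall i, 0 < ubar i 0.
Hypothesis gamma_gt0 : 0 < gamma.
Hypothesis nu_gt0 : 0 < nu.
Hypothesis th01 : 0 < th < 1.

Let f (w : R -> 'cV[R]_k) (t : R) (x : 'cV[R]_n) :=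
  Acl *m x + Bcl *m deadzone ubar (C *m x) + Bw *m w t.

Hypothesis dissip : forall x (v : 'cV[R]_k),
  nu * (1 - th) ^+ 2 * qform P x <= 1 ->
  2 * dotv (Acl *m x + Bcl *m deadzone ubar (C *m x) + Bw *m v) (P *m x)
    + gamma^-1 * qform W (sat ubar (C *m x)) + th * qform P x <= qform Rw v.

(** The level up to which [dissip] applies. It lies strictly above [nu^-1], which is the gap needed
    by the barrier argument. *)
Let b := (nu * (1 - th) ^+ 2)^-1.

Let b_gt : nu^-1 < b.
Proof.
case/andP: th01 => th0 th1.
have t0 : 0 < 1 - th by lra.
have t1 : 1 - th < 1 by lra.
rewrite ltf_pV2 ?posrE ?mulr_gt0// ?exprn_gt0//.
by rewrite gtr_pMr// exprn_ilt1 ?ltW.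
Qed.

Let dissip_le_b x v : qform P x <= b ->
  2 * dotv (Acl *m x + Bcl *m deadzone ubar (C *m x) + Bw *m v) (P *m x)
    + gamma^-1 * qform W (sat ubar (C *m x)) + th * qform P x <= qform Rw v.
Proof.
case/andP: th01 => th0 th1 xb; apply: dissip; move: xb.
by rewrite -ler_pdivlMl ?mulr1// mulr_gt0// exprn_gt0// subr_gt0.
Qed.

(** Shared by the disturbed and undisturbed cases: the second hypothesis is a budget for initial
    storage plus supplied energy. Here [th V] is dropped and the actuator term plays the role of
    [psi]. *)
Lemma closed_loop_storage w x : is_trajectory (f w) x ->
  (forall T, 0 <= T ->
    mu.-integrable `[0, T] (EFin \o (fun t => qform Rw (w t))) /\
    qform P (x 0) + \int[mu]_(t in `[0, T]) qform Rw (w t) <= nu^-1) ->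
  (forall t, 0 <= t -> ellipsoid P nu (x t)) /\
  (actuator_energy W ubar (fun t => C *m x t) <= (gamma * nu^-1)%:E)%E.
Proof.
move=> fx wE; case/andP: th01 => th0 th1.
pose psi xi := gamma^-1 * qform W (sat ubar (C *m xi)).
have psi0 xi : 0 <= psi xi by rewrite mulr_ge0 ?posdef_ge0// invr_ge0 ltW.
have satc T : 0 <= T ->
    {within `[0, T], continuous (fun s => qform W (sat ubar (C *m x s)))}.
  move=> T0; apply: within_continuous_qform => i.
  apply: within_continuous_sat => //; apply: within_continuous_mulmx => j.
  exact: (@trajectory_continuous _ _ _ _ fx T T0 j).
have psic T : 0 <= T -> {within `[0, T], continuous (fun s => psi (x s))}.
  move=> T0; apply: within_continuousM; last exact: satc.
  by move=> s; exact: cvg_cst.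
have diss t xi : 0 <= t -> qform P xi <= b ->
    2 * dotv (f w t xi) (P *m xi) + psi xi <= qform Rw (w t).
  move=> _ xb; apply: le_trans (dissip_le_b (w t) xb).
  by rewrite lerDl mulr_ge0 ?posdef_ge0// ltW.
have H T (T0 : 0 <= T) := storage_le (proj1 Pp) fx psi0 psic
  (fun T T0 => proj1 (wE T T0)) diss b_gt T0 (fun T T0 => proj2 (wE T T0)).
split=> [t t0|]; first exact: (proj1 (H t t0)).
apply: integral_halfline_le => [t|//|T T0]; first exact: posdef_ge0.
have [_ /le_trans/(_ (proj2 (wE T T0)))] := H T T0.
rewrite RintegralZl//; last exact: within_continuous_integrable (satc T T0).
move=> hT; rewrite -ler_pdivrMl//; apply: le_trans hT.
by rewrite lerDr posdef_ge0.
Qed.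

(** Conversely to [closed_loop_storage], the actuator term is dropped and [th V] is kept. *)
Lemma closed_loop_stable :
  asymptotically_stable_in (f (fun=> 0)) (ellipsoid P nu).
Proof.
case/andP: th01 => th0 th1; rewrite -(invrK nu).
apply: (decay_asymptotically_stable Pp th0 _ b_gt); first by rewrite invr_gt0.
move=> t xi _ xb; have := dissip_le_b 0 xb.
have : 0 <= gamma^-1 * qform W (sat ubar (C *m xi)).
  by rewrite mulr_ge0 ?posdef_ge0// invr_ge0 ltW.
have -> : qform Rw 0 = 0 by rewrite qformE mulmx0 dotv0.
by rewrite /f; lra.
Qed.

Lemma closed_loop_undisturbed x : is_trajectory (f (fun=> 0)) x ->
  ellipsoid P nu (x 0) ->
  (actuator_energy W ubar (fun t => C *m x t) <= (gamma * nu^-1)%:E)%E.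
Proof.
move=> fx x0; apply: (closed_loop_storage fx _).2 => T T0.
have q0 : qform Rw 0 = 0 by rewrite qformE mulmx0 dotv0.
by rewrite q0 Rintegral0 addr0; split; [exact: integrable_cst0|exact: x0].
Qed.

Lemma closed_loop_disturbed w x beta : disturbances sigma Rw w ->
  is_trajectory (f w) x -> beta^-1 <= nu^-1 - sigma^-1 ->
  ellipsoid P beta (x 0) ->
  (forall t, 0 <= t -> ellipsoid P nu (x t)) /\
  (actuator_energy W ubar (fun t => C *m x t) <= (gamma * nu^-1)%:E)%E.
Proof.
move=> dw fx bE x0; apply: closed_loop_storage fx _ => T T0.
have [iT wT] := disturbance_integral Rwp dw T0; split=> //.
by move: x0 bE wT; rewrite /ellipsoid /=; lra.
Qed.

End ClosedLoop.

(** * Invertibility facts for the change of variables *)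

Section MatrixFacts.
Context {R : realType}.

Lemma posdef_congr n (X U : 'M[R]_n) : U \in unitmx -> posdefmx X ->
  posdefmx (U *m X *m U^T).
Proof.
move=> Uu [XT X0]; split; first by rewrite !trmx_mul trmxK XT mulmxA.
move=> v v0.
have -> : qform (U *m X *m U^T) v = qform X (U^T *m v).
  by rewrite !qformE -!mulmxA dotv_mulmxr.
apply: X0; apply: contra_neq v0 => /(congr1 (mulmx (invmx U^T))).
by rewrite mulKmx ?unitmx_tr// mulmx0.
Qed.

(** At [(v, 0)] the form equals [- 2 v^T X v], so the form of [X] is positive. *)
Lemma negdef_ul_unit m n (X : 'M[R]_m) (Y : 'M[R]_(m, n)) (Z : 'M[R]_n) :
  negdefmx (symblock (- X - X^T) Y Z) -> X \in unitmx.
Proof.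
move=> [_ neg]; apply: posdef_unit => v v0.
have : col_mx v (0 : 'cV[R]_n) != 0.
  by apply: contra_neq v0; rewrite -col_mx0 => /eq_col_mx[].
move=> /neg; rewrite qform_symblock mulmx0 dotv0 [qform Z 0]qformE mulmx0 dotv0.
have -> : - X - X^T = - He X by rewrite opprD.
by rewrite qformN qform_He; lra.
Qed.

(** Pairing the equation with [u] makes the form of [W] vanish at [N u]. *)
Lemma posdef_gram_injective m n (W : 'M[R]_m) (N : 'M[R]_(m, n))
    (u : 'cV[R]_n) : posdefmx W -> N^T *m W *m N *m u = 0 -> N *m u = 0.
Proof.
move=> [_ W0] Nu; apply/eqP/negPn/negP => /W0.
by rewrite qformE dotv_mulmxl !mulmxA Nu dotv0 ltxx.
Qed.

(** An invertible [U] preserves full row rank, and the zero block adds nothing to it, so the square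
    block [X] carries all of it. *)
Lemma row_free_mul_unit m n (C : 'M[R]_(m, n + m)) (U : 'M[R]_(n + m))
    (X : 'M[R]_m) : row_free C -> U \in unitmx -> C *m U = row_mx 0 X ->
  X \in unitmx.
Proof.
move=> Cf Uu CU; rewrite -row_free_unit; apply/inj_row_free => u uX.
have : u *m C *m U = 0 by rewrite -mulmxA CU mul_mx_row mulmx0 uX row_mx0.
move=> /(congr1 (mulmx^~ (invmx U))); rewrite mulmxK// mul0mx => /eqP.
by rewrite mulmx_free_eq0// => /eqP.
Qed.

End MatrixFacts.

(** * Recovery of the gains from the linearizing variables *)

Theorem theorem2 (R : realType) (np nc nf mc ma q nw : nat)
  (Ap : 'M[R]_np) (Bp : 'M[R]_(np, mc)) (Bw : 'M[R]_(np, nw))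
  (Cp : 'M[R]_(q, np))
  (Ac : 'M[R]_nc) (Bc : 'M[R]_(nc, q)) (Cc : 'M[R]_(mc, nc))
  (Dc : 'M[R]_(mc, q))
  (M : 'M[R]_(mc, ma)) (Md : 'M[R]_(ma, mc)) (N : 'M[R]_(ma, nf))
  (W : 'M[R]_ma) (ubar : 'cV[R]_ma) (sigma : R) (Rw : 'M[R]_nw)
  (mc_lt_ma : (mc < ma)%N) (nfE : nf = (ma - mc)%N)
  (ctrl : controllable Ap Bp) (obsv : observable Cp Ap)
  (M_full : row_free M) (MdP : right_pseudo_inverse M Md) (NP : ker_basis M N)
  (W_diag : is_diag_mx W) (W_pos : posdefmx W)
  (ubar_gt0 : forall i, 0 < ubar i 0)
  (sigma_gt0 : 0 < sigma) (Rw_pos : posdefmx Rw) :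
  let A0 : 'M[R]_(np + nc) :=
    block_mx (Ap + Bp *m Dc *m Cp) (Bp *m Cc) (Bc *m Cp) Ac in
  let A : 'M[R]_(np + nc + nf) := block_mx A0 0 0 0 in
  let B : 'M[R]_(np + nc + nf, ma) :=
    col_mx (col_mx Bp (0 : 'M[R]_(nc, mc))) (0 : 'M[R]_(nf, mc)) *m M in
  let bBw : 'M[R]_(np + nc + nf, nw) := col_mx (col_mx Bw 0) 0 in
  let C : 'M[R]_(ma, np + nc + nf) :=
    row_mx (row_mx (Md *m Dc *m Cp) (Md *m Cc)) N in
  let bC : 'M[R]_(nf, np + nc + nf) := N^T *m W *m C in
  let Lc : 'M[R]_(np + nc + nf, nc) :=
    (row_mx (row_mx (0 : 'M[R]_(nc, np)) 1%:M) (0 : 'M[R]_(nc, nf)))^T in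
  let Lf : 'M[R]_(np + nc + nf, nf) :=
    (row_mx (row_mx (0 : 'M[R]_(nf, np)) (0 : 'M[R]_(nf, nc))) 1%:M)^T in
  let L : 'M[R]_(np + nc + nf, nc + nf) := row_mx Lc Lf in
  forall
  (A0_hurwitz : hurwitz A0)
  (Cperp : 'M[R]_(np + nc + nf, np + nc)) (CperpE : bC *m Cperp = 0)
  (bP : 'M[R]_(np + nc + nf)) (Jo : 'M[R]_(np + nc))
  (Jf : 'M[R]_(nf, np + nc + nf)) (bKf : 'M[R]_nf)
  (Ke : 'M[R]_(nc + nf, ma)) (bG : 'M[R]_(ma, np + nc + nf))
  (S : 'M[R]_ma) (gamma mu : R)
  (bP_pos : posdefmx bP) (S_diag : is_diag_mx S) (S_pos : posdefmx S)
  (gamma_gt0 : 0 < gamma) (mu_gt0 : 0 < mu),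
  let bJ : 'M[R]_(np + nc + nf) := (row_mx (Cperp *m Jo^T) Jf^T)^T in
  let Z : 'M[R]_(np + nc + nf) := block_mx 0 0 0 bKf in
  let Wh : 'M[R]_ma := sqrt_diagmx W in
  let Psi12 := bP + A *m bJ^T + Z - bJ in
  let Psi13 := B *m S + L *m Ke in
  let Psi22 := He (A *m bJ^T + Z) in
  let Psi23 := Psi13 - bG^T - bJ *m C^T in
  forall
  (LMI1 : negdefmx
    (symblock (- bJ - bJ^T)
       (row_mx Psi12 (row_mx Psi13 (row_mx (0 : 'M[R]_(_, ma)) bBw)))
    (symblock Psi22
       (row_mx Psi23 (row_mx (bJ *m C^T *m Wh) bBw))
    (symblock (- (2 *: S))
       (row_mx (S *m Wh) (0 : 'M[R]_(_, nw)))
    (symblock (- gamma%:M : 'M[R]_ma)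
       (0 : 'M[R]_(_, nw))
    (- Rw))))))
  (LMI2 : forall i : 'I_ma,
    possemidefmx (symblock bP (row i bG)^T (mu * ubar i 0 ^+ 2)%:M))
  (LMI3 : 0 <= sigma - mu),
  let E : 'M[R]_(nc + nf, ma) := Ke *m invmx S in
  let Kf : 'M[R]_nf := bKf *m invmx (bC *m Jf^T) in
  let J := invmx bJ in
  let P := J *m bP *m J^T in
  let closed_loop (w : R -> 'cV[R]_nw) (t : R) (x : 'cV[R]_(np + nc + nf)) :=
    (A + Lf *m Kf *m bC) *m x + (B + L *m E) *m deadzone ubar (C *m x)
    + bBw *m w t in
  let admissible_beta (beta : R) :=
    0 < beta^-1 /\ beta^-1 <= mu^-1 - sigma^-1 in
  [/\ (* the gains and P are well defined *)
      bC *m Jf^T \in unitmx /\ bJ \in unitmx,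
      asymptotically_stable_in (closed_loop (fun=> 0)) (ellipsoid P mu),
      forall (w : R -> 'cV[R]_nw) (x : R -> 'cV[R]_(np + nc + nf)),
        is_trajectory (closed_loop w) x ->
        (w = (fun=> 0) /\ ellipsoid P mu (x 0)) \/
        (disturbances sigma Rw w /\
         exists2 beta, admissible_beta beta & ellipsoid P beta (x 0)) ->
        (actuator_energy W ubar (fun t => C *m x t) <= (gamma * mu^-1)%:E)%E
    & forall (w : R -> 'cV[R]_nw) (beta : R) (x : R -> 'cV[R]_(np + nc + nf)),
        disturbances sigma Rw w -> admissible_beta beta ->
        is_trajectory (closed_loop w) x -> ellipsoid P beta (x 0) ->
        forall t, 0 <= t -> ellipsoid P mu (x t)].
Proof.
move=> A0 A B bBw C bC Lc Lf L A0_hurwitz Cperp CperpE bP Jo Jf bKf Ke bG S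
  gamma mu bP_pos S_diag S_pos gamma_gt0 mu_gt0 bJ Z Wh Psi12 Psi13 Psi22 Psi23
  LMI1 LMI2 LMI3 E Kf J P closed_loop admissible_beta.
have bJu : bJ \in unitmx := negdef_ul_unit LMI1.
(* The choice of [Cperp] annihilates the first block; this structure of [bJ] is what makes [Kf]
   recoverable. *)
have bCJ : bC *m bJ^T = row_mx 0 (bC *m Jf^T).
  by rewrite /bJ trmxK mul_mx_row mulmxA CperpE mul0mx.
(* The last block of [bC] is [N^T W N], which is injective because [W] is positive definite and the
   columns of [N] are independent. *)
have bCf : row_free bC.
  apply/inj_row_free => u ubC.
  have : u *m (N^T *m W *m N) = 0.
    by move: ubC; rewrite /bC /C !mul_mx_row -row_mx0 => /eq_row_mx[_].
  move=> /(congr1 trmx); rewrite trmx0 !trmx_mul trmxK (proj1 W_pos) mulmxA.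
  move=> /(posdef_gram_injective W_pos)/(congr1 trmx).
  rewrite trmx0 trmx_mul trmxK => /eqP.
  by rewrite mulmx_free_eq0; [move/eqP|case: NP].
have Xu : bC *m Jf^T \in unitmx.
  by apply: row_free_mul_unit bCf _ bCJ; rewrite unitmx_tr.
(* The product [Kf (bC Jf^T)] collapses to [bKf], so the bilinear term becomes the linear variable
   [Z]. *)
have AclJ : (A + Lf *m Kf *m bC) *m bJ^T = A *m bJ^T + Z.
  rewrite mulmxDl -[Lf *m Kf *m bC *m _]mulmxA bCJ /Kf -mulmxA mul_mx_row.
  rewrite mulmx0 mulmxKV//; congr (_ + _).
  by rewrite /Lf tr_row_mx trmx1 row_mx0 trmx0 mul_col_row !mul0mx !mul1mx.
have Su : S \in unitmx by apply: posdef_unit; case: S_pos.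
have BclS : (B + L *m E) *m S = Psi13.
  by rewrite mulmxDl /E -mulmxA mulmxKV.
have Pp : posdefmx P by apply: posdef_congr bP_pos; rewrite unitmx_inv.
(* The first matrix inequality is rewritten in terms of the closed-loop matrices, as [dissipation]
   expects. *)
move: LMI1; rewrite /Psi12 /Psi22 /Psi23 -BclS -[bP + _ + Z]addrA -AclJ => LMI1.
have [th th01 dissip] :=
  dissipation bJu S_diag S_pos W_diag W_pos gamma_gt0 mu_gt0 ubar_gt0 LMI1 LMI2.
split; first by [].
- exact: (closed_loop_stable Pp W_pos gamma_gt0 mu_gt0 th01 dissip).
- move=> w x wx [[w0 x0]|[dw [beta [_ betaE] x0]]].
    move: wx; rewrite w0 => wx.
    exact: (closed_loop_undisturbed Pp W_pos ubar_gt0 gamma_gt0 mu_gt0 th01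
      dissip wx x0).
  exact: (closed_loop_disturbed Pp W_pos Rw_pos ubar_gt0 gamma_gt0 mu_gt0 th01
    dissip dw wx betaE x0).2.
- move=> w beta x dw [_ betaE] wx x0.
  exact: (closed_loop_disturbed Pp W_pos Rw_pos ubar_gt0 gamma_gt0 mu_gt0 th01
    dissip dw wx betaE x0).1.
Qed.
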